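(* Let $d\ge2$ and $\sigma>0$. Let $\alpha$ be a probability measure on $\mathbb{R}^d$ with density $f_\alpha$ and let $\Omega_\alpha$ be the interior of the support of $\alpha$. Assume that $\Omega_\alpha$ is bounded and connected with Lipschitz boundary $\partial\Omega_\alpha$, and that there exists $\lambda\ge1$ such that $\lambda^{-1}\le f_\alpha(z)\le\lambda$ for all $z\in\Omega_\alpha$. Let $y_i$, $i\in\mathbb{N}$, be i.i.d. random variables with distribution $\alpha$ and $\alpha_n=\frac1n\sum_{i=1}^n\delta_{y_i}$. Then, for the covariance tensor fields associated with the truncation kernel, there exist $N=N(\sigma,\Omega_\alpha,\lambda)\in\mathbb{N}$ and a constant $A=A(\sigma,\Omega_\alpha,\lambda)>0$ such that $$\mathbb{E}\left[\sup_{x\in\mathbb{R}^d}\left\|\Sigma_{\alpha_n}(x,\sigma)-\Sigma_\alpha(x,\sigma)\right\|\right]\le A\,r_d(n)$$ for all $n\ge N$, where $r_2(n)=\frac{\ln(n)^{3/4}}{n^{1/2}}$ and $r_d(n)=\frac{\ln(n)^{1/d}}{n^{1/d}}$ for $d\ge3$.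
   Context: The truncation kernel is $T(x,y,\sigma)=\frac{1}{\sigma^d\nu_d}\chi\!\left(\frac{\|y-x\|^2}{\sigma^2}\right)$, where $\chi$ is the characteristic function of $[0,1]$ and $\nu_d$ is the volume of the unit ball in $\mathbb{R}^d$. For a Borel probability measure $\alpha$, $\Sigma_\alpha(x,\sigma)=\int(y-x)\otimes(y-x)\,T(x,y,\sigma)\,\alpha(dy)\in\mathbb{R}^d\otimes\mathbb{R}^d$; identifying $x\otimes y$ with $xy^T$, $\|\cdot\|$ is the Frobenius norm. *)

(* Defs.v *)
From HB Require Import structures.
From mathcomp Require Import all_boot all_order all_algebra finmap.
From mathcomp Require Import all_classical all_reals all_analysis.
From mathcomp Require Import measurable_realfun.

Set Implicit Arguments.
Unset Strict Implicit.
Unset Printing Implicit Defensive.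

Import Order.TTheory GRing.Theory Num.Theory.
Import numFieldNormedType.Exports.

Local Open Scope classical_set_scope.
Local Open Scope ring_scope.

(* R^d is 'rV[R]_d. Its library norm, which gives the
   topology, is the sup norm; the Euclidean norm is frob_norm below. *)

(* 'rV[R]_n carries no library sigma-algebra; this is the Borel one. *)
Section borel_rV.
Context {R : realType} {n : nat}.
HB.instance Definition _ :=
  @isMeasurable.Build (sigma_display (@open 'rV[R]_n)) 'rV[R]_n
    <<s @open 'rV[R]_n >> (@sigma_algebra0 _ setT _) (@sigma_algebraC _ _)
    (@sigma_algebra_bigcup _ setT _).
End borel_rV.

Section measurability_rV.
Context {R : realType}.

Lemma open_measurable_rV n (U : set 'rV[R]_n) : open U -> measurable U.
Proof. by move=> oU; exact: sub_sigma_algebra. Qed.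

Lemma measurable_fun_coord n (i : 'I_n) :
  measurable_fun [set: 'rV[R]_n] (fun v => v ord0 i).
Proof.
apply: (measurability _ (RGenOpens.measurableE R)) => //.
move=> _ [_ [a [b ->] <-]]; rewrite setTI.
apply: open_measurable_rV; apply: open_comp; last exact: interval_open.
by move=> v _; exact: coord_continuous.
Qed.

Lemma open_rV_bigcup n (U : set 'rV[R]_n) : open U ->
  exists B : set ('rV[rat]_n * nat), U = \bigcup_(q in B)
    [set v : 'rV[R]_n |
      forall i, ball (ratr (q.1 ord0 i) : R) q.2.+1%:R^-1 (v ord0 i)].
Proof.
move=> oU.
exists [set q : 'rV[rat]_n * nat | [set v : 'rV[R]_n | forall i,
  ball (ratr (q.1 ord0 i) : R) q.2.+1%:R^-1 (v ord0 i)] `<=` U].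
apply/seteqP; split => [x Ux|x [q qU qx]]; last exact: qU.
have /nbhs_ballP[e /= e0 eU] : nbhs x U by exact: open_nbhs_nbhs.
have [k ke] : exists k, k.+1%:R^-1 < e / 2.
  have e20 : 0 < e / 2 by rewrite divr_gt0.
  exists (Num.trunc (e / 2)^-1); rewrite invf_plt ?posrE ?ltr0n//.
  by rewrite truncnS_gt.
have H i : exists r : rat, ball (ratr r : R) k.+1%:R^-1 (x ord0 i).
  have k0 : 0 < k.+1%:R^-1 :> R by rewrite invr_gt0.
  have [z [/= xr [r _ rE]]] := @dense_rat R (ball (x ord0 i) k.+1%:R^-1)
    (ex_intro _ (x ord0 i) (ballxx _ k0)) (ball_open (x ord0 i) _).
  by exists r; rewrite rE; exact: ball_sym.
have [f fP] := choice H.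
exists (\row_i f i, k) => /=; last by move=> i; rewrite mxE.
move=> v /= vf; apply: eU; split => // j i; rewrite (ord1 j).
have := vf i; rewrite mxE => fv.
rewrite [e]splitr. apply: (@ball_triangle _ _ (ratr (f i) : R)).
  by apply: (le_ball (ltW ke)); exact/ball_sym/fP.
exact: (le_ball (ltW ke)).
Qed.

Lemma measurable_fun_rVP d (T : measurableType d) n (g : T -> 'rV[R]_n) :
  (forall i, measurable_fun setT (fun t => g t ord0 i)) ->
  measurable_fun setT g.
Proof.
move=> mg; apply: (@measurability _ _ _ _ setT g (@open 'rV[R]_n)) => //.
move=> _ [U oU <-]; rewrite setTI.
have [B ->] := open_rV_bigcup oU.
rewrite preimage_bigcup bigcup_mkcond.
apply: countable_bigcupT_measurable => [|q]; first exact: countableP.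
case: ifPn => // _.
rewrite [X in measurable X](_ : _ = \bigcap_(i in [set: 'I_n])
  ((fun t => g t ord0 i) @^-1` ball (ratr (q.1 ord0 i) : R) q.2.+1%:R^-1)).
  apply: fin_bigcap_measurable => // i _; rewrite -[X in measurable X]setTI.
  by apply: mg => //; exact: measurable_ball.
by apply/seteqP; split => [t h i _|t h i]; [exact: h|exact: (h i I)].
Qed.

End measurability_rV.

Section lebesgue_rV.
Context {R : realType}.

Definition cons_rV n (p : measurableTypeR R * 'rV[R]_n) : 'rV[R]_n.+1 :=
  row_mx ((p.1 : R)%:M : 'rV_1) p.2.

Definition uncons_rV n (v : 'rV[R]_n.+1) : measurableTypeR R * 'rV[R]_n :=
  (v ord0 ord0, rsubmx (v : 'rV_(1 + n))).

Lemma cons_rV0 n p : @cons_rV n p ord0 ord0 = p.1.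
Proof.
have -> : @ord0 n = lshift n (@ord0 0) by exact: val_inj.
by rewrite [LHS]row_mxEl mxE eqxx mulr1n.
Qed.

Lemma cons_rVS n p i : @cons_rV n p ord0 (lift ord0 i) = p.2 ord0 i.
Proof.
have -> : lift ord0 i = rshift 1 i by exact: val_inj.
by rewrite [LHS]row_mxEr.
Qed.

Lemma cons_rVK n : cancel (@cons_rV n) (@uncons_rV n).
Proof.
by move=> [x v]; rewrite /uncons_rV cons_rV0 /cons_rV row_mxKr.
Qed.

Lemma measurable_cons_rV n : measurable_fun setT (@cons_rV n).
Proof.
apply: measurable_fun_rVP => i; have [j ->|->] := unliftP ord0 i.
- under eq_fun do rewrite cons_rVS.
  exact: measurableT_comp (measurable_fun_coord j) measurable_snd.
- under eq_fun do rewrite cons_rV0.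
  exact: measurable_fst.
Qed.

Lemma measurable_uncons_rV n : measurable_fun setT (@uncons_rV n).
Proof.
apply/measurable_fun_pairP; split; first exact: measurable_fun_coord.
apply: measurable_fun_rVP => i.
rewrite (_ : (fun _ => _) = (fun v : 'rV[R]_n.+1 => v ord0 (rshift 1 i))).
  exact: measurable_fun_coord.
by apply/funext => v; rewrite /= mxE.
Qed.

Section step.
Variables (n : nat) (mu : {sigma_finite_measure set (measurableTypeR R) -> \bar R})
  (m : {sigma_finite_measure set 'rV[R]_n -> \bar R}).

Definition cons_measure : set 'rV[R]_n.+1 -> \bar R :=
  pushforward (mu \x m)%E (@cons_rV n).


Let step0 : cons_measure set0 = 0%E.
Proof. by rewrite /cons_measure /pushforward preimage_set0 measure0. Qed.

Let step_ge0 A : (0 <= cons_measure A)%E.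
Proof. by rewrite /cons_measure /pushforward measure_ge0. Qed.

Let step_sigma_additive : semi_sigma_additive cons_measure.
Proof.
move=> F mF tF mUF; rewrite /cons_measure /pushforward preimage_bigcup.
have mC A : measurable A -> measurable (@cons_rV n @^-1` A).
  by move=> mA; rewrite -[X in measurable X]setTI; exact: measurable_cons_rV.
apply: measure_semi_sigma_additive; [by move=> k; exact: mC| |].
- apply/trivIsetP => i j _ _ ij; rewrite -preimage_setI.
  by move/trivIsetP : tF => /(_ _ _ _ _ ij) ->//; rewrite preimage_set0.
- by rewrite -preimage_bigcup; exact: mC.
Qed.

HB.instance Definition _ := isMeasure.Build _ _ _ cons_measure
  step0 step_ge0 step_sigma_additive.

Let step_sigma_finite : sigma_finite setT cons_measure.
Proof.
have [F TF mF] := sigma_finiteT mu; have [G TG mG] := sigma_finiteT m.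
have [e] : exists e : nat -> nat * nat, range e = setT.
  by have /card_esym/ppcard_eqP[e] := card_nat2; exists e; rewrite image_eq.
move=> eT.
exists (fun k => @uncons_rV n @^-1` (F (e k).1 `*` G (e k).2)).
  apply/seteqP; split => // v _.
  have [k _ Fk] : (\bigcup_k F k) (uncons_rV v).1 by rewrite -TF.
  have [l _ Gl] : (\bigcup_k G k) (uncons_rV v).2 by rewrite -TG.
  have [p _ ep] : range e (k, l) by rewrite eT.
  by exists p => //; rewrite /= ep.
move=> k; have [mFk Foo] := mF (e k).1; have [mGk Goo] := mG (e k).2; split.
  rewrite -[X in measurable X]setTI.
  by apply: measurable_uncons_rV => //; exact: measurableX.
rewrite /cons_measure /pushforward -comp_preimage (_ : _ \o _ = id); last first.
  by apply/funext => p; exact: cons_rVK.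
by rewrite preimage_id product_measure1E// lte_mul_pinfty// ge0_fin_numE.
Qed.

HB.instance Definition _ := Measure_isSigmaFinite.Build _ _ _ cons_measure
  step_sigma_finite.

End step.

(* Lebesgue measure on R^n as the n-fold product of lebesgue_measure, R^(n.+1)
   being identified with R * R^n; see lebesgue_rV_box. *)
Fixpoint lebesgue_rV n : {sigma_finite_measure set 'rV[R]_n -> \bar R} :=
  match n with
  | 0 => \d_(0 : 'rV[R]_0)
  | n'.+1 => cons_measure lebesgue_measure (lebesgue_rV n')
  end.

Lemma measurable_box n (A : 'I_n -> set R) :
  (forall i, measurable (A i)) ->
  measurable [set v : 'rV[R]_n | forall i, A i (v ord0 i)].
Proof.
move=> mA; rewrite [X in measurable X](_ : _ = \bigcap_(i in [set: 'I_n])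
  ((fun v : 'rV[R]_n => v ord0 i) @^-1` A i)); last first.
  by apply/seteqP; split => [t h i _|t h i]; [exact: h|exact: (h i I)].
apply: fin_bigcap_measurable => // i _; rewrite -[X in measurable X]setTI.
exact: (measurable_fun_coord i measurableT (mA i)).
Qed.

Lemma cons_rV_box n (A : 'I_n.+1 -> set R) :
  @cons_rV n @^-1` [set v | forall i, A i (v ord0 i)] =
  A ord0 `*` [set v : 'rV[R]_n | forall i, A (lift ord0 i) (v ord0 i)].
Proof.
apply/seteqP; split => [[x v] /= h|[x v] /= [hx hv] i].
  split => [|i].
    by have := h ord0; rewrite cons_rV0.
  by have := h (lift ord0 i); rewrite cons_rVS.
have [j ->|->] := unliftP ord0 i; first by rewrite cons_rVS.
by rewrite cons_rV0.
Qed.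

Lemma lebesgue_rV_box n (A : 'I_n -> set R) :
  (forall i, measurable (A i)) ->
  lebesgue_rV n [set v | forall i, A i (v ord0 i)] =
  (\prod_(i < n) lebesgue_measure (A i))%E.
Proof.
elim: n A => [|n IH] A mA.
  by rewrite big_ord0 /= diracE mem_set// => -[].
rewrite big_ord_recl -IH//= /cons_measure /pushforward.
rewrite cons_rV_box product_measure1E//; first exact: mA.
exact: (@measurable_box _ (fun i => A (lift ord0 i))).
Qed.

End lebesgue_rV.

Section covariance_tensor.
Context {R : realType}.

(* On row vectors this is the Euclidean norm. *)
Definition frob_norm m n (M : 'M[R]_(m, n)) : R :=
  Num.sqrt (\sum_i \sum_j M i j ^+ 2).

Definition unit_ball_volume d : R :=
  fine (lebesgue_rV d [set x : 'rV[R]_d | frob_norm x <= 1]).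

Definition trunc_kernel d (x y : 'rV[R]_d) (sigma : R) : R :=
  (sigma ^+ d * unit_ball_volume d)^-1 *
  \1_(`[0, 1]%classic) (frob_norm (y - x) ^+ 2 / sigma ^+ 2).

(* Vectors are rows, so u \otimes u, i.e. u u^T for a column u, is u^T *m u. *)
Definition cov_tensor d (alpha : {measure set 'rV[R]_d -> \bar R})
    (x : 'rV[R]_d) (sigma : R) : 'M[R]_d :=
  \matrix_(i, j) \int[alpha]_y
    (((y - x)^T *m (y - x)) i j * trunc_kernel x y sigma).

(* The sample is indexed from 0: y 0, ..., y (n-1). *)
Definition empirical_measure d (y : nat -> 'rV[R]_d) (n : nat) :
    {measure set 'rV[R]_d -> \bar R} :=
  mscale (n%:R^-1)%:nng (msum (fun i => \d_(y i)) n).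

End covariance_tensor.

Section assumptions.
Context {R : realType}.

Definition measure_support d (mu : set 'rV[R]_d -> \bar R) : set 'rV[R]_d :=
  [set x | forall U, open U -> U x -> (0 < mu U)%E].

Definition has_density d (mu : set 'rV[R]_d -> \bar R) (f : 'rV[R]_d -> R) :=
  [/\ measurable_fun setT f, forall x, 0 <= f x &
    forall A, measurable A -> mu A = (\int[lebesgue_rV d]_(x in A) (f x)%:E)%E].

Definition dot_rV d (u v : 'rV[R]_d) : R := (u *m v^T) ord0 ord0.

(* Near each boundary point, O is the strict epigraph, in the direction of a
   unit vector v, of a Lipschitz function g on the hyperplane orthogonal to v.
   This avoids choosing an orthonormal frame: only the values of g on that
   hyperplane are used. *)
Definition lipschitz_boundary d (O : set 'rV[R]_d) :=
  forall p, (closure O `\` O°) p ->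
  exists (r : R) (v : 'rV[R]_d) (g : 'rV[R]_d -> R),
    [/\ 0 < r, frob_norm v = 1,
      [lipschitz g z | z in [set z | dot_rV z v = 0]] &
      forall x, frob_norm (x - p) < r ->
        O x <-> g (x - dot_rV x v *: v) < dot_rV x v].

(* Independence is mutual: the product rule holds on every finite subfamily. *)
Definition iid_from dT (T : measurableType dT) (P : probability T R) d
    (alpha : probability 'rV[R]_d R) (y : nat -> {RV P >-> 'rV[R]_d}) :=
  (forall i A, measurable A -> distribution P (y i) A = alpha A) /\
  forall (J : {fset nat}) (A : nat -> set 'rV[R]_d),
    (forall i, measurable (A i)) ->
    P (\bigcap_(i in [set` J]) (y i @^-1` A i)) =
    (\prod_(i <- J) P (y i @^-1` A i))%E.

Definition rate d (n : nat) : R :=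
  if d == 2%N then ln n%:R `^ (3 / 4) / n%:R `^ (1 / 2)
  else ln n%:R `^ d%:R^-1 / n%:R `^ d%:R^-1.

End assumptions.

(* Main.v *)
Require Import Defs.
From HB Require Import structures.
From mathcomp Require Import all_boot all_order all_algebra finmap.
From mathcomp Require Import all_classical all_reals all_analysis.
From mathcomp Require Import measurable_realfun.
From mathcomp Require Import ring lra.

(* The bound holds uniformly over all distributions, by Vapnik-Chervonenkis
   theory. An entry of the covariance tensor integrates (y-x)_i (y-x)_j over the
   ball |y-x| <= sigma; by layer cake, its deviation is at most a constant times
   the supremum of |alpha_n(C) - alpha(C)| over the sets C cut out by two
   quadratic inequalities. Quadratic polynomials in y form a space of dimension
   at most (d+1)^2, so (Sauer-Shelah) n points have at most (n+1)^(2(d+1)^2)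
   traces on these sets, and symmetrization with a ghost sample followed by an
   exponential moment bound for random signs gives the order
   (ln n / n)^(1/2), which is below the rate for every d >= 2.
   By monotone convergence it suffices to treat finitely many sets C with
   rational coefficients; these generate finitely many atoms, so that
   symmetrization takes place in a finite product space. *)

Set Implicit Arguments.
Unset Strict Implicit.
Unset Printing Implicit Defensive.

Import Order.TTheory GRing.Theory Num.Theory.
Import numFieldNormedType.Exports.

Local Open Scope ring_scope.

(** * Traces of half-spaces on a finite set *)

Definition shatters (T : finType) (F : {set {set T}}) (S : {set T}) :=
  [forall B in powerset S, [exists A in F, A :&: S == B]].

Lemma shattersP (T : finType) (F : {set {set T}}) (S : {set T}) :
  reflect (forall B : {set T}, B \subset S -> exists2 A, A \in F & A :&: S = B)
    (shatters F S).
Proof.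
apply: (iffP forall_inP) => H B.
  move=> BS; have /exists_inP[A FA /eqP AB] : [exists A in F, A :&: S == B].
    by apply: H; rewrite powersetE.
  by exists A.
rewrite powersetE => /H[A FA AB]; apply/exists_inP; exists A => //.
exact/eqP.
Qed.

(* Split F at a point x: a set shattered by both halves also stays shattered by
   F once x is added to it. *)
Lemma card_le_shatters (T : finType) (F : {set {set T}}) :
  (#|F| <= #|[set S | shatters F S]|)%N.
Proof.
have [m] := ubnP #|F|; elim: m F => // m IH F Fm.
have [F0|/set0Pn[A FA]] := eqVneq F finset.set0; first by rewrite F0 cards0.
have [F1|[A' FA' AA']] : F = [set A] \/ exists2 A', A' \in F & A' != A.
  have [/set0Pn[A']|] := boolP (F :\ A != finset.set0).
    by rewrite !inE => /andP[? ?]; right; exists A'.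
  rewrite negbK => /eqP F0; left; rewrite -(finset.setD1K FA) F0.
  by rewrite finset.setU0.
  rewrite F1 cards1 card_gt0; apply/set0Pn; exists finset.set0; rewrite inE.
  apply/shattersP => B; rewrite finset.subset0 => /eqP ->.
  by exists A; rewrite ?set11// finset.setI0.
have [x xAA'] : exists x, (x \in A') != (x \in A).
  apply/existsP; apply: contraNT AA'; rewrite negb_exists => /forallP H.
  by apply/eqP/setP => x; have := H x; rewrite negbK => /eqP.
pose Fx b := [set B in F | (x \in B) == b].
have Fx_lt b : (#|Fx b| < #|F|)%N.
  apply/proper_card/properP; split.
    by apply/fintype.subsetP => B; rewrite inE => /andP[].
  have [xA|xA] := eqVneq (x \in A) b.
    exists A' => //; rewrite inE FA'/= -xA; exact: xAA'.
  by exists A => //; rewrite inE FA/=.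
have FE : #|F| = (#|Fx true| + #|Fx false|)%N.
  rewrite -(cardsID (Fx true) F); congr (_ + _)%N.
    by apply: eq_card => B; rewrite !inE; case: (B \in F).
  by apply: eq_card => B; rewrite !inE; case: (B \in F); case: (x \in B).
pose Sh b := [set S | shatters (Fx b) S].
have ShF b S : S \in Sh b -> shatters F S.
  rewrite inE => /shattersP H; apply/shattersP => B /H[C].
  by rewrite inE => /andP[? _] ?; exists C.
have Shx b S : S \in Sh b -> x \notin S.
  rewrite inE => /shattersP H; apply/negP => xS.
  (* Membership of [x] is constant on [Fx b]. Hence a set containing [x] is never cut in the empty
     set if [b] is true, and never in itself if [b] is false. *)
  have S'S : (if b then finset.set0 else S) \subset S.
    by case: b {H}; rewrite ?finset.sub0set.
  have [C + CS] := H _ S'S.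
  rewrite inE => /andP[_ /eqP xC]; move/setP : CS => /(_ x); rewrite inE xC xS.
  by case: b {H S'S xC}; rewrite ?inE ?xS.
have Shxx S : S \in Sh true :&: Sh false -> shatters F (x |: S).
  rewrite !inE => /andP[/shattersP H1 /shattersP H0].
  apply/shattersP => B BS.
  have BxS : B :\ x \subset S by rewrite subDset.
  have [C FC xC] : exists2 C, C \in F & ((x \in C) == (x \in B)) && (C :&: S == B :\ x).
    case: (boolP (x \in B)) => xB.
      have [C + /eqP CS] := H1 _ BxS.
      by rewrite inE => /andP[FC xC]; exists C => //; rewrite xC.
    have [C + /eqP CS] := H0 _ BxS.
    by rewrite inE => /andP[FC xC]; exists C => //; rewrite xC.
  case/andP: xC => /eqP xC /eqP CS; exists C => //.
  apply/setP => z; have [->|zx] := eqVneq z x.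
    by rewrite !inE eqxx/= andbT xC.
  by move/setP : CS => /(_ z); rewrite !inE (negbTE zx)/=.
rewrite FE (leq_trans (leq_add (IH _ _) (IH _ _)))//.
- exact: leq_trans (Fx_lt _) _.
- exact: leq_trans (Fx_lt _) _.
rewrite -/(Sh true) -/(Sh false) -cardsUI.
(* A set shattered by both halves is counted twice; its second copy becomes the set with [x] added,
   which is new as no set of [Sh b] contains [x]. *)
pose G := (fun S => x |: S) @: (Sh true :&: Sh false).
have -> : #|Sh true :&: Sh false| = #|G|.
  rewrite card_in_imset// => S S'; rewrite !inE.
  move=> /andP[S1 _] /andP[S1' _] E.
  have xS : x \notin S by apply: (@Shx true); rewrite inE.
  have xS' : x \notin S' by apply: (@Shx true); rewrite inE.
  by rewrite -(setU1K xS) E setU1K.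
rewrite -cardsUI (_ : _ :&: G = finset.set0) ?cards0 ?addn0.
  apply/subset_leq_card/fintype.subsetP => S SG; rewrite inE.
  move: SG; rewrite finset.in_setU => /orP[|/imsetP[S' S'Sh ->]]; last exact: Shxx.
  by rewrite finset.in_setU => /orP[] /ShF.
apply/setP => S; rewrite [RHS]inE finset.in_setI; apply/negP => /andP[+ /imsetP[S' _ SE]].
by rewrite finset.in_setU => /orP[] /Shx; rewrite SE setU11.
Qed.

(** Such a set is listed by a map from ['I_D] to [option T], with [None] as padding. *)
Lemma card_small_sets (T : finType) D :
  (#|[set S : {set T} | #|S| <= D]| <= #|T|.+1 ^ D)%N.
Proof.
pose f (g : {ffun 'I_D -> option T}) := [set x | Some x \in codom g].
have <- : #|{ffun 'I_D -> option T}| = (#|T|.+1 ^ D)%N.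
  by rewrite card_ffun card_option card_ord.
apply: leq_trans (leq_imset_card f _); apply/subset_leq_card/fintype.subsetP => S.
rewrite inE => SD; apply/imsetP.
exists [ffun i : 'I_D => nth None [seq Some x | x <- enum S] i] => //.
apply/setP => x; rewrite inE; apply/idP/codomP.
  move=> xS; have iS : (index x (enum S) < #|S|)%N.
    by rewrite cardE index_mem mem_enum.
  exists (Ordinal (leq_trans iS SD)); rewrite ffunE/=.
  by rewrite (nth_map x) -?cardE// nth_index// mem_enum.
move=> [i]; rewrite ffunE => xi.
have : Some x \in [seq Some x | x <- enum S].
  rewrite xi; apply: mem_nth; rewrite ltnNge; apply/negP => H.
  by rewrite nth_default in xi.
by rewrite mem_map ?mem_enum//; exact: Some_inj.
Qed.

(** With more points in [S] than elements of [J], the vectors [phi i] satisfy a linear relation [c].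
    A half-space cutting out exactly the points with negative coefficient makes every [c k * q k]
    nonpositive, although they sum to 0. *)
Lemma shatters_halfspaces_card (R : realFieldType) n (J : finType)
    (phi : 'I_n -> J -> R) (F : {set {set 'I_n}}) (S : {set 'I_n}) :
  (forall A, A \in F ->
    exists theta : J -> R, A = [set i | 0 <= \sum_j theta j * phi i j]) ->
  shatters F S -> (#|S| <= #|J|)%N.
Proof.
move=> FH /shattersP FS; rewrite leqNgt; apply/negP => JS.
pose G := \matrix_(k < #|S|, l < #|J|) phi (enum_val k) (enum_val l).
(* A positive coefficient, available up to the sign of [c], makes one of these terms strictly
   negative. *)
have [c cG [k0 ck0]] : exists2 c : 'rV[R]_#|S|, c *m G = 0 &
    exists k, 0 < c ord0 k.
  have : kermx G != 0.
    rewrite kermx_eq0 /row_free ltn_eqF//.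
    exact: leq_ltn_trans (rank_leq_col G) JS.
  case/matrix0Pn => i [k Gik].
  have rG : row i (kermx G) *m G = 0 by rewrite -row_mul mulmx_ker row0.
  have : row i (kermx G) ord0 k != 0 by rewrite mxE.
  case: ltgtP => // ck _.
    exists (- row i (kermx G)); first by rewrite mulNmx rG oppr0.
    by exists k; rewrite mxE oppr_gt0.
  by exists (row i (kermx G)) => //; exists k.
pose B := [set enum_val k | k : 'I_#|S| & c ord0 k < 0].
have BS : B \subset S.
  by apply/fintype.subsetP => _ /imsetP[k _ ->]; exact: enum_valP.
have [A /FH[theta AE] AB] := FS _ BS.
pose q (k : 'I_#|S|) := \sum_j theta j * phi (enum_val k) j.
have qE (k : 'I_#|S|) : (0 <= q k) = (c ord0 k < 0).
  have : (enum_val k \in A :&: S) = (enum_val k \in B) by rewrite AB.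
  rewrite inE enum_valP andbT AE inE => ->.
  by rewrite mem_imset ?inE//; exact: enum_val_inj.
have cq : \sum_k c ord0 k * q k = 0.
  under eq_bigr do rewrite /q mulr_sumr.
  rewrite exchange_big big1//= => j _.
  under eq_bigr do rewrite mulrCA.
  rewrite -mulr_sumr (_ : \sum_k _ = 0) ?mulr0//.
  have := congr1 (fun M : 'rV_#|J| => M ord0 (enum_rank j)) cG.
  rewrite /= mxE [X in _ = X]mxE; apply: etrans.
  by apply: eq_bigr => k _; rewrite !mxE enum_rankK.
have cq_ge0 (k : 'I_#|S|) : true -> 0 <= - (c ord0 k * q k).
  move=> _; rewrite oppr_ge0; case: (ltrP (c ord0 k) 0) => ck.
    by rewrite nmulr_rle0// qE.
  by rewrite mulr_ge0_le0// ltW// ltNge qE -leNgt.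
have : \sum_k - (c ord0 k * q k) = 0 by rewrite sumrN cq oppr0.
move=> /(psumr_eq0P cq_ge0)/(_ k0 isT)/eqP.
rewrite oppr_eq0 mulf_eq0 gt_eqF//= => /eqP qk0.
by have := qE k0; rewrite qk0 lexx => /esym; rewrite ltNge (ltW ck0).
Qed.

(** A crude Sauer-Shelah bound: a family has at most as many members as it shatters sets, and these
    have at most [#|J|] points. *)
Lemma card_halfspace_traces (R : realFieldType) n (J : finType)
    (phi : 'I_n -> J -> R) (F : {set {set 'I_n}}) :
  (forall A, A \in F ->
    exists theta : J -> R, A = [set i | 0 <= \sum_j theta j * phi i j]) ->
  (#|F| <= n.+1 ^ #|J|)%N.
Proof.
move=> FH; apply: leq_trans (card_le_shatters F) _.
have := @card_small_sets 'I_n #|J|; rewrite card_ord; apply: leq_trans.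
apply/subset_leq_card/fintype.subsetP => S; rewrite !inE.
by move=> FS; exact: (shatters_halfspaces_card FH FS).
Qed.

(** * Random signs and symmetrization *)

(** For [|u| <= 1/2], [exp (-u) >= 1 - u] gives [exp u <= 1 + u + 2 u^2]; the linear terms cancel in
    the average. *)
Lemma expR_avg_le (R : realType) (x : R) : 0 <= x -> x <= 1 / 2 ->
  (expR x + expR (- x)) / 2 <= expR (2 * x ^+ 2).
Proof.
move=> x0 x1.
have H (u : R) : - (1 / 2) <= u -> u <= 1 / 2 -> expR u <= 1 + u + 2 * u ^+ 2.
  move=> u0 u1; have := expR_ge1Dx (- u).
  rewrite expRN => Hu; have u_gt0 : 0 < 1 - u by lra.
  have : expR u <= (1 - u)^-1.
    by rewrite -[expR u]invrK lef_pV2 ?posrE// invr_gt0 expR_gt0.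
  move=> /le_trans; apply; rewrite -[leLHS]mulr1 ler_pdivrMl//.
  nra.
apply: le_trans (expR_ge1Dx _).
have := H _ (le_trans _ x0) x1; have := H (- x).
rewrite sqrrN => H1 H2.
have : expR x <= 1 + x + 2 * x ^+ 2 by apply: H2; lra.
have : expR (- x) <= 1 - x + 2 * x ^+ 2 by apply: H1; lra.
lra.
Qed.

Section rademacher.
Context {R : realType} (n : nat).
Implicit Types (s : {ffun 'I_n -> bool}) (B : {set 'I_n}).

Let sgnsum s B : R := \sum_(i in B) (-1) ^+ s i.

(** The sum over sign vectors factorizes over the coordinates: one in [B] gives [exp x + exp (-x)],
    any other gives 2. *)
Lemma rademacher_mgf_le B (x : R) : 0 <= x -> x <= 1 / 2 ->
  \sum_s expR (x * sgnsum s B) <= 2 ^+ n * expR (2 * x ^+ 2 * n%:R).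
Proof.
move=> x0 x1.
have -> : \sum_s expR (x * sgnsum s B) =
    \prod_(i < n) \sum_(b : bool) (if i \in B then expR (x * (-1) ^+ b) else 1).
  rewrite bigA_distr_bigA/=; apply: eq_bigr => s _.
  by rewrite mulr_sumr expR_sum big_mkcond.
rewrite expRM_natr -exprMn -[in leRHS](card_ord n) -prodr_const.
apply: ler_prod => i _; rewrite sumr_ge0/=; last first.
  by move=> b _; case: ifP => // _; exact: expR_ge0.
rewrite big_bool/=; case: ifP => _; last first.
  rewrite -[leLHS]/(2%:R) ler_peMr// -expR0 ler_expR.
  by rewrite mulr_ge0// sqr_ge0.
rewrite expr1 expr0 mulrN !mulr1 -ler_pdivrMl// mulrC addrC.
exact: expR_avg_le.
Qed.

(* Since [x u <= c + exp (x u - c)], the maximum is controlled by the sum of the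
   exponential moments over the distinct traces; the choice of [c] makes the
   average of that sum over the signs at most 1. *)
Lemma rademacher_max_le (I : finType) (A : I -> {set 'I_n}) (N : nat) (x : R) :
  0 < x -> x <= 1 / 2 -> (0 < N)%N -> (#|A @: I| <= N)%N ->
  \sum_s \big[Num.max/0]_k `|sgnsum s (A k)| <=
  2 ^+ n * ((ln (2 * N%:R) + 1) / x + 2 * x * n%:R).
Proof.
move=> x0 x1 N0 AN; set c : R := ln (2 * N%:R) + 2 * x ^+ 2 * n%:R.
have N2 : 1 <= 2 * N%:R :> R by rewrite -natrM ler1n muln_gt0.
have c0 : 0 <= c by rewrite addr_ge0 ?ln_ge0// mulr_ge0// mulr_ge0// sqr_ge0.
(* Flipped signs handle the absolute value, as [exp |u| <= exp u + exp (-u)]; this accounts for the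
   factor 2 in [ln (2 * N%:R)]. *)
pose neg s : {ffun 'I_n -> bool} := [ffun i => ~~ s i].
pose E s := \sum_(B in A @: I)
  (expR (x * sgnsum s B) + expR (x * sgnsum (neg s) B)).
have sgnN s B : sgnsum (neg s) B = - sgnsum s B.
  rewrite /sgnsum -sumrN; apply: eq_bigr => i _; rewrite ffunE/=.
  by case: (s i); rewrite ?expr0 ?expr1 ?opprK.
have E0 s B : B \in A @: I ->
    0 <= expR (x * sgnsum s B) + expR (x * sgnsum (neg s) B).
  by move=> _; rewrite addr_ge0// expR_ge0.
have maxE s : \big[Num.max/0]_k `|sgnsum s (A k)| <= (c + expR (- c) * E s) / x.
  apply/bigmax_leP; split=> [|k _].
    rewrite divr_ge0 ?(ltW x0)// addr_ge0// mulr_ge0 ?expR_ge0//.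
    exact: sumr_ge0.
  rewrite ler_pdivlMr// mulrC -lerBlDl.
  set u := x * _.
  have : u - c <= expR (- c) * expR u.
    rewrite -expRD addrC; apply: le_trans (expR_ge1Dx _); lra.
  move=> /le_trans; apply; rewrite ler_pM2l ?expR_gt0//.
  have AkI : A k \in A @: I by exact: imset_f.
  rewrite /E (bigD1 (A k))//= ler_wpDr//.
    by apply: sumr_ge0 => B /andP[+ _]; exact: E0.
  rewrite sgnN /u; case: (ger0P (sgnsum s (A k))) => _.
    by rewrite lerDl expR_ge0.
  by rewrite lerDr expR_ge0.
have negI : injective neg.
  move=> s s' /ffunP ss'; apply/ffunP => i.
  by have := ss' i; rewrite !ffunE/= => /negb_inj.
have sumE : \sum_s E s <= 2 ^+ n * expR c.
  rewrite exchange_big/=.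
  apply: (@le_trans _ _ (\sum_(B in A @: I) 2 * (2 ^+ n * expR (2 * x ^+ 2 * n%:R)))).
    apply: ler_sum => B _; rewrite big_split/= mulr_natl mulr2n lerD//.
      by apply: rademacher_mgf_le => //; exact: ltW.
    have -> : \sum_s expR (x * sgnsum (neg s) B) =
        \sum_s expR (x * sgnsum s B) by rewrite [RHS](reindex_inj negI).
    by apply: rademacher_mgf_le => //; exact: ltW.
  rewrite sumr_const -[leLHS]mulr_natl /c expRD lnK; last first.
    by rewrite posrE (lt_le_trans _ N2).
  rewrite [leLHS]mulrA [leLHS]mulrCA ler_pM2l ?exprn_gt0//.
  rewrite ler_pM2r ?expR_gt0// mulrC ler_pM2l// ler_nat.
  exact: AN.
apply: le_trans (ler_sum _ (fun s _ => maxE s)) _.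
rewrite -mulr_suml big_split/= sumr_const card_ffun card_bool card_ord.
rewrite -mulr_sumr ler_pdivrMr//.
have : expR (- c) * \sum_s E s <= 2 ^+ n.
  rewrite mulrC -ler_pdivlMr ?expR_gt0// -expRN opprK; exact: sumE.
rewrite -[c *+ _]mulr_natl natrX => H; apply: le_trans (lerD (lexx _) H) _.
rewrite -[X in _ + X <= _]mulr1 -mulrDr -[leRHS]mulrA ler_pM2l ?exprn_gt0//.
rewrite /c [leRHS]mulrDl divfK ?gt_eqF// le_eqVlt; apply/orP; left; apply/eqP.
ring.
Qed.

End rademacher.

Section symmetrization.
Context {R : realType} {E I : finType} (n : nat).
Variables (p : E -> R) (h : I -> E -> bool).
Hypotheses (p_ge0 : forall b, 0 <= p b) (p_sum1 : \sum_b p b = 1).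
Implicit Types (a : {ffun 'I_n -> E}) (s : {ffun 'I_n -> bool}).

(** A sample [a] consists of [n] independent draws from the law [p], and [h k b] tells whether [b]
    lies in the [k]-th set; sums against [weight] are expectations. *)
Let weight a : R := \prod_i p (a i).
Let hits k a : R := \sum_i (h k (a i))%:R.
Let dev k a : R := `|hits k a - n%:R * \sum_b p b * (h k b)%:R|.
Let sgnhits s k a : R := \sum_(i in [set i | h k (a i)]) (-1) ^+ s i.

Let weight_ge0 a : 0 <= weight a.
Proof. exact: prodr_ge0. Qed.

Let weight_sum1 : \sum_a weight a = 1.
Proof. by rewrite /weight -(bigA_distr_bigA (fun _ b => p b)) big1. Qed.

Let weight_coord i (g : E -> R) :
  \sum_a weight a * g (a i) = \sum_b p b * g b.
Proof.
transitivity
  (\sum_(a : {ffun 'I_n -> E}) \prod_j (p (a j) * (if j == i then g (a j) else 1))).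
  apply: eq_bigr => a _; rewrite big_split/=; congr (_ * _).
  by rewrite (bigD1 i)//= eqxx big1 ?mulr1// => j /negbTE ->.
rewrite -(bigA_distr_bigA (fun j b => p b * (if j == i then g b else 1))).
rewrite (bigD1 i)//= eqxx [X in _ * X]big1 ?mulr1// => j /negbTE ->.
by under eq_bigr do rewrite mulr1.
Qed.

Let hits_mean k : \sum_a weight a * hits k a = n%:R * \sum_b p b * (h k b)%:R.
Proof.
under eq_bigr do rewrite /hits mulr_sumr.
rewrite exchange_big/=.
under eq_bigr do rewrite (weight_coord _ (fun b => (h k b)%:R)).
by rewrite sumr_const card_ord mulr_natl.
Qed.

(** Jensen: the mean is the expectation of [hits] over an independent ghost sample [a'], and a
    maximum of absolute expectations is at most the expectation of the maximum. *)
Let le_ghost :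
  \sum_a weight a * \big[Num.max/0]_k dev k a <=
  \sum_a \sum_a' weight a * weight a' *
    \big[Num.max/0]_k `|hits k a - hits k a'|.
Proof.
apply: ler_sum => a _; under [leRHS]eq_bigr do rewrite -mulrA.
rewrite -mulr_sumr ler_wpM2l//; apply: bigmax_le => [|k _].
  by apply: sumr_ge0 => a' _; rewrite mulr_ge0// bigmax_ge_id.
rewrite /dev -hits_mean -[hits k a]mul1r -weight_sum1 mulr_suml -sumrB.
apply: le_trans (ler_norm_sum _ _ _) _; apply: ler_sum => a' _.
rewrite -mulrBr normrM ger0_norm// ler_wpM2l//.
exact: (le_bigmax 0 (fun k => `|hits k a - hits k a'|)).
Qed.

(* Exchanging the two samples at the coordinates selected by [s] preserves the
   product weight. *)
Let swap_le s :
  \sum_a \sum_a' weight a * weight a' *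
    \big[Num.max/0]_k `|hits k a - hits k a'| <=
  2 * \sum_a weight a * \big[Num.max/0]_k `|sgnhits s k a|.
Proof.
pose sw (z : {ffun 'I_n -> E} * {ffun 'I_n -> E}) :=
  ([ffun i => if s i then z.2 i else z.1 i] : {ffun 'I_n -> E},
   [ffun i => if s i then z.1 i else z.2 i] : {ffun 'I_n -> E}).
have swK : involutive sw.
  by move=> [a a']; congr pair; apply/ffunP => i; rewrite !ffunE/=; case: (s i).
rewrite pair_big/= (reindex_inj (inv_inj swK))/=.
have weight_sw z : weight (sw z).1 * weight (sw z).2 = weight z.1 * weight z.2.
  rewrite -!big_split/=; apply: eq_bigr => i _; rewrite !ffunE.
  by case: (s i) => //; rewrite mulrC.
have hits_sw k z : hits k (sw z).1 - hits k (sw z).2 =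
    sgnhits s k z.1 - sgnhits s k z.2.
  rewrite /hits /sgnhits -sumrB [X in _ = X - _]big_mkcond.
  rewrite [X in _ = _ - X]big_mkcond -sumrB/=; apply: eq_bigr => i _.
  rewrite !ffunE !inE; case: (s i); case: (h k (z.1 i)); case: (h k (z.2 i));
    rewrite /= ?expr0 ?expr1 ?mulr1n ?mulr0n; ring.
set M := fun a => \big[Num.max/0]_k `|sgnhits s k a|.
(* The triangle inequality separates the two samples, which have the same law; hence the factor
   2. *)
apply: (@le_trans _ _
    (\sum_z weight z.1 * weight z.2 * (M z.1 + M z.2))).
  apply: ler_sum => z _; rewrite weight_sw ler_wpM2l ?mulr_ge0//.
  apply: bigmax_le => [|k _]; first by rewrite addr_ge0// bigmax_ge_id.
  rewrite hits_sw; apply: le_trans (ler_normB _ _) _.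
  by rewrite lerD//; exact: (le_bigmax 0 (fun k => `|sgnhits s k _|)).
rewrite -(pair_big xpredT xpredT (fun a a' : {ffun 'I_n -> E} =>
  weight a * weight a' * (M a + M a')))/=.
under eq_bigr do [under eq_bigr do rewrite mulrDr; rewrite big_split/=].
rewrite big_split/= mulr_natl mulr2n lerD//.
  apply: ler_sum => a _; under eq_bigr do rewrite mulrAC.
  by rewrite -mulr_sumr weight_sum1 mulr1.
under eq_bigr do [under eq_bigr do rewrite -mulrA; rewrite -mulr_sumr].
by rewrite -mulr_suml weight_sum1 mul1r.
Qed.

(** The symmetrized bound holds for each sign vector, hence on average; for a fixed sample the
    average over signs is controlled by the number of traces. This number is bounded only on samples
    of positive weight, which will be realized by actual points. *)
Lemma finite_vc_deviation (N : nat) (x : R) :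
  0 < x -> x <= 1 / 2 -> (0 < N)%N ->
  (forall a, 0 < \prod_i p (a i) ->
    (#|[set [set i | h k (a i)] | k : I]| <= N)%N) ->
  \sum_(a : {ffun 'I_n -> E}) (\prod_i p (a i)) *
    \big[Num.max/0]_k
      `|\sum_i (h k (a i))%:R - n%:R * \sum_b p b * (h k b)%:R| <=
  2 * ((ln (2 * N%:R) + 1) / x + 2 * x * n%:R).
Proof.
move=> x0 x1 N0 HN; apply: le_trans le_ghost _.
set Q := leLHS; set B : R := _ / x + _.
have : 2 ^+ n * Q <= 2 ^+ n * (2 * B); last by rewrite ler_pM2l ?exprn_gt0.
have -> : 2 ^+ n * Q = \sum_(s : {ffun 'I_n -> bool}) Q.
  by rewrite sumr_const card_ffun card_bool card_ord -[RHS]mulr_natl natrX.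
apply: le_trans (ler_sum _ (fun s _ => swap_le s)) _.
rewrite -mulr_sumr exchange_big/= [leRHS]mulrCA ler_pM2l//.
set rhs := leRHS; rewrite -[rhs]mul1r -weight_sum1 mulr_suml; apply: ler_sum => a _.
have := weight_ge0 a; rewrite le_eqVlt => /predU1P[<-|Wa].
  by rewrite mul0r big1// => s _; rewrite mul0r.
rewrite -mulr_sumr ler_pM2l//.
exact: (rademacher_max_le x0 x1 N0 (HN _ Wa)).
Qed.

End symmetrization.

(** * Reduction of an i.i.d. sample to a finite product space *)

Local Open Scope classical_set_scope.
Local Open Scope ring_scope.

Section finite_range.
Context d (X : measurableType d) (R : realType) (E : finType).
Variables (Z : X -> E) (mZ : forall b, measurable (Z @^-1` [set b])).

Let indicE (g : E -> R) x :
  (g (Z x))%:E = (\sum_b (g b)%:E * (\1_(Z @^-1` [set b]) x)%:E)%E.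
Proof.
rewrite (bigD1 (Z x))//= big1 ?adde0 => [|b bx].
  by rewrite indicE mem_set// mule1.
by rewrite indicE memNset ?mule0//= => /esym/eqP; rewrite (negbTE bx).
Qed.

Let measurable_term (g : E -> R) b :
  measurable_fun setT (fun x => (g b)%:E * (\1_(Z @^-1` [set b]) x)%:E)%E.
Proof.
apply: emeasurable_funM => //; apply/measurable_EFinP.
exact: measurable_indic.
Qed.

Lemma measurable_fun_finite_range (g : E -> R) :
  measurable_fun setT (fun x => (g (Z x))%:E).
Proof.
under eq_fun do rewrite indicE.
by apply: emeasurable_sum => b; exact: measurable_term.
Qed.

Lemma ge0_integral_finite_range (mu : {measure set X -> \bar R}) (g : E -> R) :
  (forall b, 0 <= g b) ->
  (\int[mu]_x (g (Z x))%:E = \sum_b (g b)%:E * mu (Z @^-1` [set b]))%E.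
Proof.
move=> g0; under eq_integral do rewrite indicE.
rewrite ge0_integral_sum//; last first.
  by move=> b x _; rewrite mule_ge0// lee_fin.
apply: eq_bigr => b _; rewrite ge0_integralZl//; last by rewrite lee_fin.
  by rewrite integral_indic// setIT.
by apply/measurable_EFinP; exact: measurable_indic.
Qed.

End finite_range.

Section iid.
Context {R : realType} (d : nat) (alpha : probability 'rV[R]_d R)
  (dT : measure_display) (T : measurableType dT) (P : probability T R)
  (y : nat -> {RV P >-> 'rV[R]_d}).
Hypothesis y_iid : iid_from alpha y.

Lemma iid_cylinder n (A : 'I_n -> set 'rV[R]_d) :
  (forall i, measurable (A i)) ->
  P [set w | forall i, A i (y i w)] = (\prod_i alpha (A i))%E.
Proof.
(* Padding with [setT] gives a family indexed by all of [nat], the form in which independence is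
   assumed. *)
move=> mA; pose B m := if insub m is Some i then A i else setT.
have BE (i : 'I_n) : B i = A i by rewrite /B valK.
have mB m : measurable (B m) by rewrite /B; case: insubP.
have [yd yind] := y_iid.
have := yind [fset m in iota 0 n]%fset B mB.
rewrite (_ : \bigcap_(_ in _) _ = [set w | forall i, A i (y i w)]); last first.
  apply/seteqP; split=> [w Bw i|w Aw m].
    by have := Bw i; rewrite /= -BE; apply; rewrite !inE mem_iota ltn_ord.
  rewrite /= !inE mem_iota /= => mn; have := Aw (Ordinal mn).
  by rewrite -(BE (Ordinal mn)).
move=> ->; rewrite (perm_big (iota 0 n)); last first.
  apply: uniq_perm; [exact: fset_uniq|exact: iota_uniq|].
  by move=> m; rewrite !inE.
rewrite -[n in iota 0 n]subn0 -/(index_iota 0 n) big_mkord.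
by apply: eq_bigr => i _; rewrite -[A i]BE -(yd i _ (mB i)).
Qed.

Context (E : finType) (Z : 'rV[R]_d -> E) (n : nat).
Hypothesis mZ : forall b, measurable (Z @^-1` [set b]).

Let sample w : {ffun 'I_n -> E} := [ffun i => Z (y (i : 'I_n) w)].

Let sampleE a :
  sample @^-1` [set a] = [set w | forall i : 'I_n, (Z @^-1` [set a i]) (y i w)].
Proof.
apply/seteqP; split=> [w /= <- i|w /= H]; first by rewrite ffunE.
by apply/ffunP => i; rewrite ffunE H.
Qed.

Let measurable_sample a : measurable (sample @^-1` [set a]).
Proof.
rewrite sampleE (_ : [set _ | _] =
  \bigcap_(i in [set: 'I_n]) (y i @^-1` (Z @^-1` [set a i]))).
  by apply: fin_bigcap_measurable => // i _; exact: measurable_funPTI.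
by apply/seteqP; split => [t h i _|t h i]; [exact: h|exact: (h i I)].
Qed.

Lemma measurable_fun_iid_sample (g : {ffun 'I_n -> E} -> R) :
  measurable_fun setT (fun w => (g [ffun i => Z (y (i : 'I_n) w)])%:E).
Proof. exact: measurable_fun_finite_range measurable_sample _. Qed.

Lemma integral_iid_sample (g : {ffun 'I_n -> E} -> R) : (forall a, 0 <= g a) ->
  (\int[P]_w (g [ffun i => Z (y (i : 'I_n) w)])%:E =
   (\sum_(a : {ffun 'I_n -> E}) (\prod_i fine (alpha (Z @^-1` [set a i]))) * g a)%R%:E)%E.
Proof.
move=> g0; rewrite (ge0_integral_finite_range measurable_sample)// -sumEFin.
apply: eq_bigr => a _; rewrite muleC EFinM; congr (_ * _)%E.
rewrite sampleE; apply: etrans (iid_cylinder (fun i => mZ (a i))) _.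
rewrite -prodEFin; apply: eq_bigr => i _; rewrite fineK//.
exact: fin_num_measure.
Qed.

End iid.

(** * Expected deviation over finitely many sets *)

Section vc_expectation.
Context {R : realType} (d : nat) (alpha : probability 'rV[R]_d R)
  (dT : measure_display) (T : measurableType dT) (P : probability T R)
  (y : nat -> {RV P >-> 'rV[R]_d}).
Hypothesis y_iid : iid_from alpha y.
Context (K : finType) (C : K -> set 'rV[R]_d) (n : nat).
Hypothesis mC : forall k, measurable (C k).

(** The membership vector encodes the atom containing [v] in the algebra generated by the sets
    [C k]; [p] below is its law under [alpha]. *)
Let Z v : {ffun K -> bool} := [ffun k => v \in C k].

Let mZ b : measurable (Z @^-1` [set b]).
Proof.
rewrite (_ : _ @^-1` _ =
  \bigcap_(k in [set: K]) (if b k then C k else ~` C k)).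
  apply: fin_bigcap_measurable => // k _.
  by case: (b k) => //; exact: measurableC.
apply/seteqP; split=> [v /= <- k _|v H].
  by rewrite ffunE; case: ifPn => [|/negP]; rewrite inE.
apply/ffunP => k; rewrite ffunE; have := H k I; case: (b k) => Ck.
  by rewrite mem_set.
by rewrite memNset.
Qed.

Let p b : R := fine (alpha (Z @^-1` [set b])).

Let p_ge0 b : 0 <= p b.
Proof. exact: fine_ge0. Qed.

Let integral_p (g : {ffun K -> bool} -> R) : (forall b, 0 <= g b) ->
  (\int[alpha]_v (g (Z v))%:E = (\sum_b p b * g b)%R%:E)%E.
Proof.
move=> g0; rewrite (ge0_integral_finite_range mZ)// -sumEFin.
apply: eq_bigr => b _; rewrite muleC EFinM /p fineK//.
exact: fin_num_measure.
Qed.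

Let p_sum1 : \sum_b p b = 1.
Proof.
have := @integral_p (fun=> 1) (fun=> ler01).
rewrite integral_cst// mul1e => pE; apply: EFin_inj.
rewrite -[RHS](probability_setT alpha) [RHS]pE; congr EFin.
by apply: eq_bigr => b _; rewrite mulr1.
Qed.

Let p_sumC k : \sum_b p b * (b k)%:R = fine (alpha (C k)).
Proof.
have := @integral_p (fun b => (b k)%:R) (fun b => ler0n _ _).
under eq_integral do rewrite ffunE -indicE.
by rewrite integral_indic// setIT => ->.
Qed.

Let G (a : {ffun 'I_n -> {ffun K -> bool}}) : R :=
  \big[Num.max/0]_k `|n%:R^-1 * \sum_i (a i k)%:R - fine (alpha (C k))|.

Let GE w : \big[Num.max/0]_k
    `|n%:R^-1 * \sum_(i < n) \1_(C k) (y i w) - fine (alpha (C k))| =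
  G [ffun i => Z (y (i : 'I_n) w)].
Proof.
apply: eq_bigr => k _; congr `|_ * _ - _|; apply: eq_bigr => i _.
by rewrite !ffunE indicE.
Qed.

Lemma measurable_empirical_deviation :
  measurable_fun setT (fun w => (\big[Num.max/0]_k
    `|n%:R^-1 * \sum_(i < n) \1_(C k) (y i w) - fine (alpha (C k))|)%:E).
Proof.
by under eq_fun do rewrite GE; exact: measurable_fun_iid_sample.
Qed.

(** The deviation depends on the sample only through its atoms, so its expectation is a finite sum
    over the product space. *)
Lemma vc_expectation (N : nat) (x : R) :
  0 < x -> x <= 1 / 2 -> (0 < N)%N -> (0 < n)%N ->
  (forall v : 'I_n -> 'rV[R]_d,
    (#|[set [set i | v i \in C k] | k : K]%SET| <= N)%N) ->
  (\int[P]_w (\big[Num.max/0]_k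
    `|n%:R^-1 * \sum_(i < n) \1_(C k) (y i w) - fine (alpha (C k))|)%:E <=
  (n%:R^-1 * (2 * ((ln (2 * N%:R) + 1) / x + 2 * x * n%:R)))%:E)%E.
Proof.
move=> x0 x1 N0 n0 HN; under eq_integral do rewrite GE.
rewrite (integral_iid_sample y_iid mZ); last by move=> a; exact: bigmax_ge_id.
rewrite lee_fin.
have nI : 0 < n%:R^-1 :> R by rewrite invr_gt0 ltr0n.
apply: (@le_trans _ _ (n%:R^-1 *
  \sum_(a : {ffun 'I_n -> {ffun K -> bool}}) (\prod_i p (a i)) *
    \big[Num.max/0]_k `|\sum_(i < n) (a i k)%:R -
       n%:R * \sum_b p b * ((b : {ffun K -> bool}) k)%:R|)).
  rewrite mulr_sumr; apply: ler_sum => a _; rewrite mulrCA.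
  apply: ler_wpM2l; first by apply: prodr_ge0 => i _; exact: p_ge0.
  rewrite /G; apply: bigmax_le => [|k _].
    by rewrite mulr_ge0 ?(ltW nI)// bigmax_ge_id.
  rewrite -[X in `|_ - X|](@mulKf _ n%:R) ?pnatr_eq0 -?lt0n//.
  rewrite -mulrBr normrM gtr0_norm// ler_pM2l// -p_sumC.
  exact: (le_bigmax 0 (fun k => `|\sum_i (a i k)%:R -
    n%:R * \sum_b p b * ((b : {ffun K -> bool}) k)%:R|)).
rewrite ler_pM2l//.
apply: (finite_vc_deviation (h := fun k b => (b : {ffun K -> bool}) k)) => // a Wa.
(* A sample of atoms with positive weight has no empty atom, so actual points realize it and the
   trace count applies to them. *)
have [v vP] : exists v : 'I_n -> 'rV[R]_d, forall i, Z (v i) = a i.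
  suff H i : exists v, Z v = a i by have [v vP] := choice H; exists v.
  apply: contrapT => /forallNP H; move: Wa.
  rewrite (bigD1 i)//= /p (_ : _ @^-1` _ = set0) ?measure0 ?mul0r ?ltxx//.
  by apply/seteqP; split => // u /= /H.
apply: leq_trans (HN v); apply/eq_leq; congr #|pred_of_set _|.
apply: eq_imset => k; apply/setP => i.
by rewrite !inE -vP ffunE.
Qed.

End vc_expectation.

(** * Sets defined by two quadratic inequalities *)

Section quadrics.
Context {R : realType} (d : nat).
Implicit Types (y : 'rV[R]_d) (M : 'M[R]_d.+1).

(* With [1] prepended to [y], every polynomial of degree at most 2 in [y]
   becomes a quadratic form. *)
Definition quad_mon y (j : 'I_d.+1 * 'I_d.+1) : R :=
  cons_rV (1, y) ord0 j.1 * cons_rV (1, y) ord0 j.2.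

Definition quad M y : R := \sum_j M j.1 j.2 * quad_mon y j.

(** The first inequality will cut out a ball, the second a level set inside it. *)
Definition quad_set M M' : set 'rV[R]_d :=
  [set y | 0 <= quad M y /\ 0 <= quad M' y].

(** This form is [1 + |y|^2]; it dominates all monomials and so measures a change of coefficients
    uniformly in [y]. *)
Lemma quad1E y : quad 1%:M y = \sum_i cons_rV (1, y) ord0 i ^+ 2.
Proof.
rewrite /quad -(pair_bigA _ (fun i j => (1%:M : 'M[R]_d.+1) i j * quad_mon y (i, j)))/=.
apply: eq_bigr => i _; rewrite (bigD1 i)//= big1 ?addr0 => [|j ji].
  by rewrite mxE eqxx mul1r.
by rewrite mxE eq_sym (negbTE ji) mul0r.
Qed.

Lemma quad1_ge0 y : 0 <= quad 1%:M y.
Proof. by rewrite quad1E sumr_ge0// => i _; exact: sqr_ge0. Qed.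

Lemma quadD M M' y : quad (M + M') y = quad M y + quad M' y.
Proof. by rewrite -big_split; apply: eq_bigr => j _; rewrite mxE mulrDl. Qed.

Lemma quadDscalar M c y : quad (M + c%:M) y = quad M y + c * quad 1%:M y.
Proof.
rewrite quadD; congr (_ + _); rewrite mulr_sumr; apply: eq_bigr => j _.
by rewrite !mxE mulrA mulr_natr.
Qed.

Lemma normr_quad_mon_le y j : `|quad_mon y j| <= quad 1%:M y.
Proof.
have sq (i : 'I_d.+1) : cons_rV (1, y) ord0 i ^+ 2 <= quad 1%:M y.
  by rewrite quad1E (bigD1 i)//= lerDl sumr_ge0// => k _; exact: sqr_ge0.
have := sq j.1; have := sq j.2; rewrite /quad_mon.
set a := cons_rV _ _ _; set b := cons_rV _ _ _ => ha hb.
by rewrite ler_norml; apply/andP; split; nra.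
Qed.

Lemma measurable_quad M : measurable_fun setT (quad M).
Proof.
apply: measurable_sum => j; apply: measurable_funM => //.
suff H (i : 'I_d.+1) : measurable_fun setT
    (fun y : 'rV[R]_d => cons_rV (1, y) ord0 i : R) by exact: measurable_funM.
have [k ->|->] := unliftP ord0 i.
  by under eq_fun do rewrite cons_rVS; exact: measurable_fun_coord.
by under eq_fun do rewrite cons_rV0; exact: measurable_cst.
Qed.

Lemma measurable_quad_set M M' : measurable (quad_set M M').
Proof.
rewrite (_ : quad_set M M' =
  (quad M @^-1` `[0, +oo[) `&` (quad M' @^-1` `[0, +oo[)); last first.
  by apply/seteqP; split=> y /=; rewrite !in_itv/= !andbT.
by apply: measurableI; rewrite -[X in measurable X]setTI;
  apply: measurable_quad.
Qed.

(** A rational matrix close to [M + (e / 2)%:M] is off by at most [e / 2 * quad 1%:M y], which keeps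
    it between the two forms at every [y]. *)
Lemma quad_rat_approx M (e : R) : 0 < e -> exists q : 'M[rat]_d.+1, forall y,
  quad M y <= quad (map_mx ratr q) y <= quad (M + e%:M) y.
Proof.
move=> e0; pose c : R := #|{: 'I_d.+1 * 'I_d.+1}|%:R.
have c0 : 0 < c by rewrite ltr0n card_prod card_ord.
pose e1 := e / (2 * c).
have e10 : 0 < e1 by rewrite divr_gt0// mulr_gt0.
have H (j : 'I_d.+1 * 'I_d.+1) : exists r : rat,
    `|ratr r - (M + (e / 2)%:M) j.1 j.2| < e1.
  set x : R := (M + _) _ _.
  have [r] := rat_in_itvoo (ltr_pwDr e10 (lexx x)).
  rewrite in_itv/= => /andP[xr rx]; exists r.
  by rewrite gtr0_norm ?subr_gt0// ltrBlDl.
have [f fP] := choice H.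
exists (\matrix_(i, j) f (i, j)) => y.
set q := map_mx _ _.
have qE : `|quad q y - quad (M + (e / 2)%:M) y| <= e / 2 * quad 1%:M y.
  rewrite /quad -sumrB; apply: le_trans (ler_norm_sum _ _ _) _.
  apply: (@le_trans _ _ (\sum_(j : 'I_d.+1 * 'I_d.+1) e1 * quad 1%:M y)).
    apply: ler_sum => j _; rewrite -mulrBl normrM ler_pM//.
      by rewrite /q !mxE -surjective_pairing; have := fP j; rewrite !mxE => /ltW.
    exact: normr_quad_mon_le.
  rewrite sumr_const -[leLHS]mulr_natl -/c mulrA.
  suff -> : c * e1 = e / 2 by [].
  by rewrite /e1; field; rewrite gt_eqF.
move: qE; rewrite ler_distl !quadDscalar => /andP[q1 q2].
by apply/andP; split; lra.
Qed.

(** The enlarged sets decrease to [quad_set M M'], as its inequalities are not strict; the claim is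
    continuity from above. *)
Lemma quad_set_shrink (mu : {measure set 'rV[R]_d -> \bar R}) M M' (e : R) :
  (mu setT < +oo)%E -> 0 < e ->
  \forall m \near \oo, fine (mu (quad_set (M + m.+1%:R^-1%:M) (M' + m.+1%:R^-1%:M)))
    < fine (mu (quad_set M M')) + e.
Proof.
move=> muT e0.
pose A m := quad_set (M + m.+1%:R^-1%:M) (M' + m.+1%:R^-1%:M).
have fin_mu B : measurable B -> mu B \is a fin_num.
  move=> mB; rewrite ge0_fin_numE//; apply: le_lt_trans muT.
  by apply: le_measure; rewrite ?inE//; exact: measurableT.
have AE : \bigcap_m A m = quad_set M M'.
  apply/seteqP; split=> [y H|y [My M'y] m _]; last first.
    by split; rewrite quadDscalar addr_ge0// mulr_ge0 ?quad1_ge0.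
  have lim N : (forall m, 0 <= quad (N + m.+1%:R^-1%:M) y) -> 0 <= quad N y.
    move=> HN; rewrite leNgt; apply/negP => Ny.
    (* At this [k] the added term is smaller than [- quad N y], so the perturbed form would be
       negative. *)
    pose k := Num.trunc (quad 1%:M y / - quad N y).
    have : quad 1%:M y / - quad N y < k.+1%:R by rewrite truncnS_gt.
    have := HN k; rewrite quadDscalar.
    rewrite ltr_pdivrMr ?oppr_gt0// => h1 h2.
    have k0 : 0 < k.+1%:R :> R by rewrite ltr0n.
    have : 0 <= k.+1%:R * (quad N y + k.+1%:R^-1 * quad 1%:M y).
      by rewrite mulr_ge0.
    by rewrite mulrDr mulrA divff ?gt_eqF// mul1r; lra.
  by split; apply: lim => m; case: (H m I).
have cvgA : (fine \o (mu \o A)) m @[m --> \oo] --> fine (mu (quad_set M M')).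
  apply: fine_cvg; rewrite fineK; last by apply: fin_mu; exact: measurable_quad_set.
  rewrite -AE; apply: nonincreasing_cvg_mu.
  - apply: le_lt_trans muT; apply: le_measure => //; rewrite inE.
      exact: measurable_quad_set.
    exact: measurableT.
  - by move=> i; exact: measurable_quad_set.
  - by rewrite AE; exact: measurable_quad_set.
  - move=> m k mk; apply/subsetPset => y [h1 h2].
    have inv_le : k.+1%:R^-1 * quad 1%:M y <= m.+1%:R^-1 * quad 1%:M y.
      by rewrite ler_wpM2r ?quad1_ge0// lef_pV2 ?posrE ?ltr0n// ler_nat ltnS.
    move: h1 h2; rewrite /A /quad_set/= !quadDscalar => h1 h2.
    by split; [apply: le_trans h1 _|apply: le_trans h2 _]; rewrite lerD2l.
move/cvgrPdist_lt : cvgA => /(_ _ e0); apply: filterS => m /=.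
by rewrite ltr_distlC => /andP[].
Qed.

(** A rational set [B'] lies between [B] and an enlargement [B''] that gains less than [e] in both
    measures, so the deviations on [B] and [B'] differ by at most [e]. *)
Lemma quad_set_rat_dense (mu nu : {measure set 'rV[R]_d -> \bar R}) (r : R) :
  (mu setT < +oo)%E -> (nu setT < +oo)%E ->
  (forall q q' : 'M[rat]_d.+1,
    `|fine (mu (quad_set (map_mx ratr q) (map_mx ratr q'))) -
      fine (nu (quad_set (map_mx ratr q) (map_mx ratr q')))| <= r) ->
  forall M M', `|fine (mu (quad_set M M')) - fine (nu (quad_set M M'))| <= r.
Proof.
move=> muT nuT H M M'; apply/ler_addgt0Pr => e e0.
have [m _ mH] : \forall m \near \oo,
    fine (mu (quad_set (M + m.+1%:R^-1%:M) (M' + m.+1%:R^-1%:M)))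
      < fine (mu (quad_set M M')) + e /\
    fine (nu (quad_set (M + m.+1%:R^-1%:M) (M' + m.+1%:R^-1%:M)))
      < fine (nu (quad_set M M')) + e.
  near=> m; split; near: m; exact: quad_set_shrink.
have [mu_m nu_m] := mH m (leqnn m).
have m0 : 0 < m.+1%:R^-1 :> R by rewrite invr_gt0 ltr0n.
have [q qP] := quad_rat_approx M m0; have [q' q'P] := quad_rat_approx M' m0.
set B := quad_set M M'; set B' := quad_set (map_mx ratr q) (map_mx ratr q').
set B'' := quad_set (M + m.+1%:R^-1%:M) (M' + m.+1%:R^-1%:M) in mu_m nu_m *.
have BB' : B `<=` B'.
  move=> y [h h']; have /andP[h1 _] := qP y; have /andP[h2 _] := q'P y.
  by split; [exact: le_trans h1|exact: le_trans h2].
have B'B'' : B' `<=` B''.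
  move=> y [h h']; have /andP[_ h1] := qP y; have /andP[_ h2] := q'P y.
  by split; [exact: le_trans h1|exact: le_trans h2].
have le_fine (m' : {measure set 'rV[R]_d -> \bar R}) C C' :
    (m' setT < +oo)%E -> measurable C -> measurable C' -> C `<=` C' ->
    fine (m' C) <= fine (m' C').
  move=> m'T mC mC' CC'.
  have fin_m' D : measurable D -> m' D \is a fin_num.
    move=> mD; rewrite ge0_fin_numE//; apply: le_lt_trans m'T.
    by apply: le_measure; rewrite ?inE//; exact: measurableT.
  by rewrite fine_le ?fin_m'// le_measure// inE.
have mB := measurable_quad_set.
have := le_fine mu _ _ muT (mB _ _) (mB _ _) BB'.
have := le_fine nu _ _ nuT (mB _ _) (mB _ _) BB'.
have := le_fine mu _ _ muT (mB _ _) (mB _ _) B'B''.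
have := le_fine nu _ _ nuT (mB _ _) (mB _ _) B'B''.
have := H q q'; rewrite -/B -/B' !ler_norml => /andP[h1 h2] h3 h4 h5 h6.
move: mu_m nu_m; rewrite -/B => h7 h8.
by apply/andP; split; lra.
Unshelve. all: by end_near. Qed.

(** Each inequality is a half-space in the [d.+1 * d.+1] monomials, and a trace is an intersection
    of two half-space traces; hence the square. *)
Lemma card_quad_set_traces n (v : 'I_n -> 'rV[R]_d) (I : finType)
    (M M' : I -> 'M[R]_d.+1) :
  (#|[set [set i | v i \in quad_set (M k) (M' k)] | k : I]%SET| <=
   (n.+1 ^ (d.+1 * d.+1)) ^ 2)%N.
Proof.
pose F : {set {set 'I_n}} := [set A : {set 'I_n} |
  `[< exists theta : 'I_d.+1 * 'I_d.+1 -> R,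
        A = [set i | 0 <= \sum_j theta j * quad_mon (v i) j]%SET >]]%SET.
have cF : (#|F| <= n.+1 ^ (d.+1 * d.+1))%N.
  have := @card_halfspace_traces R n _ (fun i => quad_mon (v i)) F.
  by rewrite card_prod card_ord; apply => A; rewrite inE => /asboolP.
apply: leq_trans (_ : #|[set (A :&: B)%SET | A in F, B in F]%SET| <= _)%N.
  apply/subset_leq_card/fintype.subsetP => _ /imsetP[k _ ->].
  pose tr (N : 'M[R]_d.+1) := [set i | 0 <= quad N (v i)]%SET.
  have trF N : tr N \in F.
    by rewrite inE; apply/asboolP; exists (fun j => N j.1 j.2).
  apply/imset2P; exists (tr (M k)) (tr (M' k)) => //.
  by apply/setP => i; rewrite !inE; apply/idP/andP => [/set_mem[]|?];
    [|exact/mem_set].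
rewrite curry_imset2X; apply: leq_trans (leq_imset_card _ _) _.
by rewrite cardsX mulnn leq_exp2r.
Qed.

End quadrics.

(** * Layer cake *)

Section layer_cake.
Context {R : realType}.

(** [S] is [a] rounded down to a multiple of [h], each level not above [a] contributing [h]. *)
Lemma step_approx (a h : R) m : 0 < h -> 0 <= a -> a <= m%:R * h ->
  let S := \sum_(l < m) h * (l.+1%:R * h <= a)%R%:R in S <= a <= S + h.
Proof.
move=> h0 a0 am; pose S k := \sum_(l < k) h * (l.+1%:R * h <= a)%R%:R.
(* After [k] levels, either [a] is within [h] of the partial sum or all [k] levels were counted. *)
have H k : [/\ S k <= a, S k <= k%:R * h & a < S k + h \/ S k = k%:R * h].
  elim: k => [|k [IH1 IH2 IH3]].
    by rewrite /S big_ord0 mul0r; split => //; right.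
  rewrite /S big_ord_recr/= -/(S k); have kh : k.+1%:R * h = k%:R * h + h.
    by rewrite -natr1 mulrDl mul1r.
  case: (lerP (k.+1%:R * h) a) => ka; rewrite ?mulr1 ?mulr0 ?addr0.
    have Sk : S k = k%:R * h by case: IH3 => // ?; lra.
    by rewrite Sk -kh; split => //; right.
  by split => //; [lra|left; case: IH3; lra].
have [S1 S2 S3] := H m; rewrite /= -/(S m) S1/=.
by case: S3 => [/ltW//|->]; lra.
Qed.

Context d (X : measurableType d).
Implicit Types (mu nu : {measure set X -> \bar R}) (f : X -> R).

Lemma bounded_finite_integrable mu f (c : R) : (mu setT < +oo)%E ->
  measurable_fun setT f -> (forall x, `|f x| <= c) ->
  mu.-integrable setT (EFin \o f).
Proof.
move=> muT mf fc; apply: measurable_bounded_integrable => //.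
by exists c; split; [exact: num_real|move=> r /ltW cr x _; exact: le_trans cr].
Qed.

Let level f (t : R) : set X := [set x | t <= f x].

(** Rounding [f] down to multiples of [c / m] costs at most [c / m] pointwise and turns the integral
    into a sum over levels. *)
Lemma layer_cake_approx mu f (c : R) m : (mu setT < +oo)%E ->
  measurable_fun setT f -> 0 < c -> (forall x, 0 <= f x <= c) -> (0 < m)%N ->
  `|\int[mu]_x f x -
    \sum_(l < m) c / m%:R * fine (mu (level f (l.+1%:R * (c / m%:R))))| <=
  c / m%:R * fine (mu setT).
Proof.
move=> muT mf c0 fc m0; set h := c / m%:R.
have mR : 0 < m%:R :> R by rewrite ltr0n.
have h0 : 0 < h by rewrite divr_gt0.
have mA t : measurable (level f t).
  rewrite (_ : level f t = setT `&` f @^-1` `[t, +oo[); first exact: mf.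
  by rewrite setTI; apply/seteqP; split=> x /=; rewrite in_itv/= andbT.
have finA A : measurable A -> mu A \is a fin_num.
  move=> mA'; rewrite ge0_fin_numE//; apply: le_lt_trans muT.
  by apply: le_measure; rewrite ?inE//; exact: measurableT.
pose S x : R := \sum_(l < m) h * \1_(level f (l.+1%:R * h)) x.
have SE x : S x = \sum_(l < m) h * (l.+1%:R * h <= f x)%R%:R.
  apply: eq_bigr => l _; rewrite indicE; congr (_ * (nat_of_bool _)%:R).
  by apply/idP/idP => [/set_mem//|?]; exact/mem_set.
have Sf x : S x <= f x <= S x + h.
  have /andP[f0 f1] := fc x; rewrite SE; apply: step_approx => //.
  by rewrite /h mulrCA divff ?gt_eqF// mulr1.
have mS : measurable_fun setT S.
  by apply: measurable_sum => l; apply: measurable_funM.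
have S0 x : 0 <= S x.
  by apply: sumr_ge0 => l _; rewrite mulr_ge0// ltW.
have iS : mu.-integrable setT (EFin \o S).
  apply: (@bounded_finite_integrable _ _ c) => // x; rewrite ger0_norm//.
  have /andP[h1 _] := Sf x; have /andP[_ h2] := fc x; exact: le_trans h2.
have if_ : mu.-integrable setT (EFin \o f).
  apply: (@bounded_finite_integrable _ _ c) => // x.
  by have /andP[f0 f1] := fc x; rewrite ger0_norm.
have ih : mu.-integrable setT (EFin \o (fun _ : X => h)).
  by apply: (@bounded_finite_integrable _ _ `|h|).
have <- : \int[mu]_x S x = \sum_(l < m) h * fine (mu (level f (l.+1%:R * h))).
  rewrite /Rintegral; under eq_integral do rewrite /S -sumEFin.
  rewrite ge0_integral_sum//; last first.
  - by move=> l x _; rewrite lee_fin mulr_ge0// ltW.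
  - by move=> l; apply/measurable_EFinP; apply: measurable_funM.
  rewrite -[RHS]/(fine _%:E) -sumEFin; congr fine; apply: eq_bigr => l _.
  under eq_integral do rewrite EFinM.
  rewrite ge0_integralZl//; last first.
  - by rewrite lee_fin ltW.
  - by apply/measurable_EFinP; exact: measurable_indic.
  by rewrite integral_indic// setIT [RHS]EFinM fineK// finA.
have hT : \int[mu]_x h = h * fine (mu setT).
  by rewrite /Rintegral integral_cst// fineM// finA.
rewrite -hT; have intSh : \int[mu]_x (S x + h) = \int[mu]_x S x + \int[mu]_x h.
  by rewrite RintegralD.
have h1 : \int[mu]_x S x <= \int[mu]_x f x.
  by apply: le_Rintegral => // x _; case/andP: (Sf x).
have h2 : \int[mu]_x f x <= \int[mu]_x (S x + h).
  apply: le_Rintegral => //; last by move=> x _; case/andP: (Sf x).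
  apply: (@bounded_finite_integrable _ _ (c + h)) => //.
    exact: measurable_funD.
  move=> x; rewrite ger0_norm ?addr_ge0 ?(ltW h0)// lerD2r.
  have /andP[h3 _] := Sf x; have /andP[_ h4] := fc x; exact: le_trans h4.
by rewrite ger0_norm ?subr_ge0// lerBlDl -intSh.
Qed.

(** Each of [m] levels has weight [c / m] and deviates by at most [r], in total [c * r]; the
    rounding error vanishes as [m] grows. *)
Lemma dist_Rintegral_levels mu nu f (c r : R) :
  (mu setT < +oo)%E -> (nu setT < +oo)%E -> measurable_fun setT f ->
  0 < c -> (forall x, 0 <= f x <= c) ->
  (forall t, 0 < t ->
    `|fine (mu [set x | t <= f x]) - fine (nu [set x | t <= f x])| <= r) ->
  `|\int[mu]_x f x - \int[nu]_x f x| <= c * r.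
Proof.
move=> muT nuT mf c0 fc H; apply/ler_addgt0Pr => e e0.
pose V := fine (mu setT) + fine (nu setT).
have V0 : 0 <= V by rewrite addr_ge0// fine_ge0.
pose m := (Num.trunc (c * V / e)).+1.
have mR : 0 < m%:R :> R by rewrite ltr0n.
have mV : c / m%:R * V <= e.
  rewrite mulrAC ler_pdivrMr// [leRHS]mulrC -ler_pdivrMr//.
  by rewrite ltW// /m truncnS_gt.
have := layer_cake_approx muT mf c0 fc (ltn0Sn _ : 0 < m)%N.
have := layer_cake_approx nuT mf c0 fc (ltn0Sn _ : 0 < m)%N.
set Smu := \sum_(l < m) _ * fine (mu _); set Snu := \sum_(l < m) _ * fine (nu _).
have : `|Smu - Snu| <= c * r.
  rewrite /Smu /Snu -sumrB; apply: le_trans (ler_norm_sum _ _ _) _.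
  apply: (@le_trans _ _ (\sum_(l < m) c / m%:R * r)).
    apply: ler_sum => l _; rewrite -mulrBr normrM ger0_norm; last first.
      by rewrite divr_ge0 ?ltW.
    apply: ler_wpM2l; first by rewrite divr_ge0 ?ltW.
    apply: H.
    by rewrite mulr_gt0// divr_gt0.
  by rewrite sumr_const card_ord -[leLHS]mulr_natr mulrAC divfK ?gt_eqF.
have : c / m%:R * fine (mu setT) + c / m%:R * fine (nu setT) <= e.
  by rewrite -mulrDr.
rewrite !ler_norml => h1 /andP[h2 h3] /andP[h4 h5] /andP[h6 h7].
by apply/andP; split; lra.
Qed.

End layer_cake.

(** * Deviation of covariance tensors *)

Section covariance.
Context {R : realType} (d : nat).
Implicit Types (f g : 'rV[R]_d -> R) (x y : 'rV[R]_d).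

Definition is_quad f := exists M, forall y, quad M y = f y.

Lemma is_quadD f g : is_quad f -> is_quad g -> is_quad (fun y => f y + g y).
Proof.
by move=> [M Mf] [N Ng]; exists (M + N) => y; rewrite quadD Mf Ng.
Qed.

Lemma is_quadN f : is_quad f -> is_quad (fun y => - f y).
Proof.
move=> [M Mf]; exists (- M) => y; rewrite -Mf /quad -sumrN.
by apply: eq_bigr => j _; rewrite mxE mulNr.
Qed.

Lemma is_quad_sum (I : finType) (h : I -> 'rV[R]_d -> R) :
  (forall i, is_quad (h i)) -> is_quad (fun y => \sum_i h i y).
Proof.
move=> hq; elim: (index_enum I) => [|i s IH].
  exists 0 => y; rewrite big_nil /quad big1// => j _.
  by rewrite mxE mul0r.
have [M HM] := is_quadD (hq i) IH; exists M => y.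
by rewrite HM big_cons.
Qed.

Let ext y : 'rV[R]_d.+1 := cons_rV (1, y).

(** Since [ext y] starts with 1, the factors are arbitrary affine functions of [y]. *)
Lemma is_quad_mulmx (a b : 'rV[R]_d.+1) :
  is_quad (fun y => (\sum_i a ord0 i * ext y ord0 i) *
                    (\sum_i b ord0 i * ext y ord0 i)).
Proof.
exists (\matrix_(i, j) (a ord0 i * b ord0 j)) => y.
rewrite /quad big_distrlr pair_bigA/=; apply: eq_bigr => j _.
by rewrite mxE mulrACA.
Qed.

Lemma is_quad_coordM x i j :
  is_quad (fun y => (y - x) ord0 i * (y - x) ord0 j).
Proof.
(* Coefficients of the affine function [y_k - x_k]. *)
pose a k : 'rV[R]_d.+1 := cons_rV (- x ord0 k, delta_mx ord0 k).
have aE k y : \sum_l a k ord0 l * ext y ord0 l = (y - x) ord0 k.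
  rewrite big_ord_recl /a /ext !cons_rV0 mulr1 (bigD1 k)//= !cons_rVS.
  rewrite mxE !eqxx mul1r big1 ?addr0 => [|l lk].
    by rewrite !mxE addrC.
  by rewrite !cons_rVS mxE (negbTE lk) andbF mul0r.
have [M HM] := is_quad_mulmx (a i) (a j).
by exists M => y; rewrite HM !aE.
Qed.

Lemma is_quad_const (c : R) : is_quad (fun=> c).
Proof.
pose a (r : R) : 'rV[R]_d.+1 := cons_rV (r, 0).
have aE r y : \sum_l a r ord0 l * ext y ord0 l = r.
  rewrite big_ord_recl /a /ext !cons_rV0 mulr1 big1 ?addr0// => l _.
  by rewrite !cons_rVS mxE mul0r.
have [M HM] := is_quad_mulmx (a c) (a 1).
by exists M => y; rewrite HM !aE mulr1.
Qed.

Lemma is_quad_measurable f : is_quad f -> measurable_fun setT f.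
Proof.
move=> [M HM]; rewrite (_ : f = quad M); first exact: measurable_quad.
by apply/funext => y; rewrite HM.
Qed.

Lemma sqr_frob_norm_row (v : 'rV[R]_d) :
  frob_norm v ^+ 2 = \sum_k v ord0 k * v ord0 k.
Proof.
rewrite /frob_norm big_ord1 sqr_sqrtr; last first.
  by apply: sumr_ge0 => k _; exact: sqr_ge0.
by apply: eq_bigr => k _; rewrite expr2.
Qed.

Lemma normr_coordM_le (v : 'rV[R]_d) i j :
  `|v ord0 i * v ord0 j| <= \sum_k v ord0 k * v ord0 k.
Proof.
have sq l : v ord0 l * v ord0 l <= \sum_k v ord0 k * v ord0 k.
  rewrite [leRHS](bigD1 l)//= lerDl sumr_ge0// => k _.
  by rewrite -expr2 sqr_ge0.
have := sq i; have := sq j.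
set a := v _ _; set b := v _ _ => ha hb.
by rewrite ler_norml; apply/andP; split; nra.
Qed.

Lemma frob_norm_le_entries (M : 'M[R]_d) (b : R) : 0 <= b ->
  (forall i j, `|M i j| <= b) -> frob_norm M <= d%:R * b.
Proof.
move=> b0 Mb; rewrite /frob_norm -[leRHS]ger0_norm ?mulr_ge0// -sqrtr_sqr.
rewrite ler_wsqrtr//.
apply: (@le_trans _ _ (\sum_(i < d) \sum_(j < d) b ^+ 2)).
  apply: ler_sum => i _; apply: ler_sum => j _.
  by rewrite -real_normK ?num_real// ler_sqr ?nnegrE.
rewrite sumr_const sumr_const card_ord -mulrnA -[leLHS]mulr_natl natrM.
by rewrite exprMn expr2.
Qed.

(** Up to the kernel constant, an entry integrates [u] over the ball [B]. It is the integral of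
    [g = (u + sigma^2) 1_B], with values in [[0, 2 sigma^2]], minus [sigma^2] times the mass of [B];
    these deviate by at most [2 sigma^2 r] and [sigma^2 r]. The factor [d] comes from the Frobenius
    norm of [d^2] entries. *)
Lemma cov_tensor_dist_le (mu nu : {measure set 'rV[R]_d -> \bar R})
    x (sigma r : R) : 0 < sigma -> 0 <= r ->
  (mu setT < +oo)%E -> (nu setT < +oo)%E ->
  (forall M M', `|fine (mu (quad_set M M')) - fine (nu (quad_set M M'))| <= r) ->
  frob_norm (cov_tensor mu x sigma - cov_tensor nu x sigma) <=
  d%:R * (`|(sigma ^+ d * unit_ball_volume d)^-1| * (3 * sigma ^+ 2 * r)).
Proof.
move=> s0 r0 muT nuT H; set c : R := (_ * _)^-1.
have s20 : 0 < sigma ^+ 2 by rewrite exprn_gt0.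
apply: frob_norm_le_entries => [|i j].
  by rewrite mulr_ge0// mulr_ge0// mulr_ge0// ltW.
pose sq y := \sum_k (y - x) ord0 k * (y - x) ord0 k.
pose u y := (y - x) ord0 i * (y - x) ord0 j.
pose B : set 'rV[R]_d := [set y | sq y <= sigma ^+ 2].
have [MB MBE] : is_quad (fun y => sigma ^+ 2 - sq y).
  apply: is_quadD; first exact: is_quad_const.
  by apply: is_quadN; apply: is_quad_sum => k; exact: is_quad_coordM.
(* The zero form makes the second inequality void, so the ball alone is a [quad_set]. *)
have [M0 M0E] := is_quad_const 0.
have BE : B = quad_set MB M0.
  by apply/seteqP; split=> y; rewrite /B/= /quad_set/= MBE M0E subr_ge0 ?lexx;
    [move=> ->|case].
have mB : measurable B by rewrite BE; exact: measurable_quad_set.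
pose g y := (u y + sigma ^+ 2) * \1_B y.
have mu_ : measurable_fun setT u.
  by apply: is_quad_measurable; exact: is_quad_coordM.
have m1 : measurable_fun setT (\1_B : 'rV[R]_d -> R) by exact: measurable_indic.
have mg : measurable_fun setT g.
  by apply: measurable_funM => //; apply: measurable_funD.
have uB y : B y -> `|u y| <= sigma ^+ 2.
  by move=> By; apply: le_trans (normr_coordM_le _ _ _) By.
have g_bd y : 0 <= g y <= 2 * sigma ^+ 2.
  rewrite /g indicE; have [yB|yB] := boolP (y \in B).
    have := uB _ (set_mem yB); rewrite ler_norml mulr1 => /andP[h1 h2].
    by apply/andP; split; lra.
  by rewrite mulr0 lexx/= mulr_ge0// ltW.
(* Positivity of [t] excludes the points outside [B], where [g] is 0. *)
have g_level t : 0 < t -> exists M, [set y | t <= g y] = quad_set MB M.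
  move=> t0; have [M ME] : is_quad (fun y => u y + (sigma ^+ 2 - t)).
    by apply: is_quadD; [exact: is_quad_coordM|exact: is_quad_const].
  exists M; apply/seteqP; split=> y; rewrite /quad_set/= MBE ME subr_ge0.
    rewrite /g indicE; have [yB|yB] := boolP (y \in B); last by rewrite mulr0; lra.
    by rewrite mulr1 => tg; split; [exact: set_mem yB|lra].
  by move=> [By uy]; rewrite /g indicE mem_set// mulr1; lra.
have dg : `|\int[mu]_y g y - \int[nu]_y g y| <= 2 * sigma ^+ 2 * r.
  apply: dist_Rintegral_levels => //; first by rewrite mulr_gt0.
  by move=> t /g_level[M ->]; exact: H.
have covE (m : {measure set 'rV[R]_d -> \bar R}) : (m setT < +oo)%E ->
    cov_tensor m x sigma i j = c * (\int[m]_y g y - sigma ^+ 2 * fine (m B)).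
  move=> mT.
  have ig : m.-integrable setT (EFin \o g).
    apply: (@bounded_finite_integrable _ _ _ _ _ (2 * sigma ^+ 2)) => // y.
    by have /andP[h1 h2] := g_bd y; rewrite ger0_norm.
  have i1 : m.-integrable setT (EFin \o (\1_B : 'rV[R]_d -> R)).
    apply: (@bounded_finite_integrable _ _ _ _ _ 1) => // y.
    by rewrite indicE; case: (_ \in _); rewrite ?normr1 ?normr0.
  have i2 : m.-integrable setT (EFin \o (fun y => sigma ^+ 2 * \1_B y)).
    exact: (integrableZl measurableT _ i1).
  have intB : \int[m]_y \1_B y = fine (m B).
    by rewrite /Rintegral integral_indic// setIT.
  rewrite mxE -intB -RintegralZl// -RintegralB// -RintegralZl//; last first.
    exact: (integrableB measurableT ig i2).
  apply: eq_Rintegral => y _.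
  rewrite /trunc_kernel -/c mxE big_ord1 [in LHS]mxE -/(u y).
  have -> : \1_(`[0, 1]%classic) (frob_norm (y - x) ^+ 2 / sigma ^+ 2) =
      \1_B y :> R.
    rewrite !indicE; congr (nat_of_bool _)%:R; rewrite sqr_frob_norm_row -/(sq y).
    apply/idP/idP => [/set_mem|/set_mem yB].
      rewrite /= in_itv/= => /andP[_]; rewrite ler_pdivrMr// mul1r => ?.
      exact/mem_set.
    apply/mem_set; rewrite /= in_itv/= ler_pdivrMr// mul1r yB andbT.
    rewrite divr_ge0 ?(ltW s20)//; apply: sumr_ge0 => k _.
    by rewrite -expr2 sqr_ge0.
  by rewrite /g; ring.
have := H MB M0; rewrite -BE => dB.
have -> : (cov_tensor mu x sigma - cov_tensor nu x sigma) i j =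
    c * ((\int[mu]_y g y - \int[nu]_y g y) -
      sigma ^+ 2 * (fine (mu B) - fine (nu B))).
  by rewrite mxE [X in _ + X]mxE !covE//; ring.
rewrite normrM ler_wpM2l//; apply: le_trans (ler_normB _ _) _.
rewrite normrM (gtr0_norm s20).
have : sigma ^+ 2 * `|fine (mu B) - fine (nu B)| <= sigma ^+ 2 * r.
  by rewrite ler_pM2l.
by lra.
Qed.

End covariance.

(** * Expected supremum *)

(** For [d = 2] the exponent 1/2 of [ln n >= 1] is raised to 3/4; for [d >= 3] the exponent 1/2 of
    [ln n / n <= 1] is lowered to [1/d]. *)
Lemma sqrt_le_rate (R : realType) (d n : nat) : (2 <= d)%N ->
  1 <= ln n%:R :> R -> Num.sqrt (ln n%:R / n%:R) <= rate d n :> R.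
Proof.
move=> d2 n1; have n0 : 0 < n%:R :> R.
  by rewrite ltNge; apply/negP => /ln0 H; move: n1; rewrite H ler10.
have ln0 : 0 <= ln n%:R :> R by exact: le_trans n1.
have q0 : 0 <= ln n%:R / n%:R :> R by rewrite divr_ge0// ltW.
have powRdiv (r : R) : (ln n%:R / n%:R) `^ r = ln n%:R `^ r / n%:R `^ r.
  rewrite powRM ?invr_ge0 ?(ltW n0)// -powR_inv1 ?(ltW n0)//.
  by rewrite powRAC powR_inv1 ?powR_ge0.
rewrite /rate -powR12_sqrt//; case: eqP => [_|_].
  rewrite powRdiv div1r ler_wpM2r ?invr_ge0 ?powR_ge0//.
  by apply: ler_powR => //; lra.
rewrite -powRdiv; apply: ger_powR; last first.
  by rewrite lef_pV2 ?posrE ?ltr0n ?(ltnW d2)// ler_nat.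
rewrite divr_gt0 ?(lt_le_trans _ n1)//= ler_pdivrMr// mul1r ltW//.
exact: ln_sublinear.
Qed.

(** The integral of a nonnegative function is a supremum over simple functions below it. This form
    applies to the supremum over all [x] without a proof that it is measurable. *)
Lemma ge0_le_integralT d (X : measurableType d) (R : realType)
    (mu : {measure set X -> \bar R}) (f g : X -> \bar R) :
  (forall x, 0 <= f x)%E -> (forall x, f x <= g x)%E ->
  (\int[mu]_x f x <= \int[mu]_x g x)%E.
Proof.
move=> f0 fg; have g0 x : (0 <= g x)%E := le_trans (f0 x) (fg x).
rewrite !ge0_integralTE//; apply: ereal_sup_le => _ [h hf <-].
by exists h => // x; exact: le_trans (hf x) (fg x).
Qed.

Lemma empirical_measureE (R : realType) d (z : nat -> 'rV[R]_d) n A :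
  empirical_measure z n A = (n%:R^-1 * \sum_(i < n) \1_A (z i))%:E.
Proof.
rewrite /empirical_measure/= /mscale/= /msum EFinM -sumEFin.
by congr (_ * _)%E; apply: eq_bigr => i _; rewrite diracE indicE.
Qed.

(* The added 1 makes the factor positive without computing the volume. *)
Definition cov_const (R : realType) d (sigma : R) : R :=
  d%:R * (`|(sigma ^+ d * unit_ball_volume d)^-1| * (3 * sigma ^+ 2)) + 1.

Lemma cov_const_gt0 (R : realType) d (sigma : R) : 0 < cov_const d sigma.
Proof. by rewrite ltr_wpDl// mulr_ge0// mulr_ge0// mulr_ge0// sqr_ge0. Qed.

(** * Passage from finitely many rational quadrics to all centers *)

Section sup_deviation.
Context {R : realType} (d : nat) (alpha : probability 'rV[R]_d R)
  (dT : measure_display) (T : measurableType dT) (P : probability T R)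
  (y : nat -> {RV P >-> 'rV[R]_d}).
Hypothesis y_iid : iid_from alpha y.
Variables (sigma : R) (n : nat).
Hypotheses (s0 : 0 < sigma) (n0 : (0 < n)%N).

Let D := cov_const d sigma.

Let D0 : 0 < D.
Proof. exact: cov_const_gt0. Qed.

(** Every pair of rational matrices is the value at its own code, so the [F m] increase to the
    supremum over all rational sets; other codes get the default [(0, 0)]. *)
Let rat_pair (k : nat) : 'M[rat]_d.+1 * 'M[rat]_d.+1 :=
  odflt (0, 0) (choice.unpickle k).

Let C k : set 'rV[R]_d :=
  quad_set (map_mx ratr (rat_pair k).1) (map_mx ratr (rat_pair k).2).

Let F m w : R := \big[Num.max/0]_(k < m)
  `|n%:R^-1 * \sum_(i < n) \1_(C k) (y i w) - fine (alpha (C k))|.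

Let F_ge0 m w : 0 <= F m w.
Proof. exact: bigmax_ge_id. Qed.

Let mF m : measurable_fun setT (fun w => (F m w)%:E).
Proof.
apply: (@measurable_empirical_deviation _ _ alpha _ _ P y _ (fun k : 'I_m => C k)) => k.
exact: measurable_quad_set.
Qed.

Let G m w : \bar R := (D%:E * (F m w)%:E)%E.

Let G_ge0 m w : (0 <= G m w)%E.
Proof. by rewrite mule_ge0// lee_fin// ltW. Qed.

Let mG m : measurable_fun setT (G m).
Proof. by apply: emeasurable_funM. Qed.

Let G_nd w : {homo G^~ w : m k / (m <= k)%N >-> (m <= k)%E}.
Proof.
move=> m k mk; rewrite lee_pmul2l ?lte_fin// lee_fin.
exact: (le_bigmax_ord xpredT (fun k =>
  `|n%:R^-1 * \sum_(i < n) \1_(C k) (y i w) - fine (alpha (C k))|) mk).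
Qed.

(** A finite limit [s] bounds every rational deviation by [s / D], hence by density every deviation
    over a [quad_set], hence the tensors at all [x] by [s]. *)
Let cov_le_lim w :
  (ereal_sup [set (frob_norm (cov_tensor (empirical_measure (y^~ w) n) x sigma
                              - cov_tensor alpha x sigma))%:E
             | x in [set: 'rV[R]_d]] <= limn (G^~ w))%E.
Proof.
have GL m : (G m w <= limn (G^~ w))%E.
  have /cvg_lim -> := ereal_nondecreasing_cvgn (@G_nd w).
    by apply: ereal_sup_ubound; exists m.
  exact: ereal_hausdorff.
case: (limn _) GL => [s| |] GL; last 2 first.
- exact: leey.
- by have := le_trans (G_ge0 0%N w) (GL 0%N).
apply: ge_ereal_sup => _ [x _ <-]; rewrite lee_fin.
have Fs m : F m w <= s / D.
  by have := GL m; rewrite /G -EFinM lee_fin ler_pdivlMr// mulrC.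
have empT : empirical_measure (y^~ w) n setT = 1%E.
  rewrite empirical_measureE; under eq_bigr do rewrite indicT.
  by rewrite sumr_const card_ord mulVf// pnatr_eq0 -lt0n.
have sD0 : 0 <= s / D := le_trans (F_ge0 0 w) (Fs 0%N).
apply: le_trans (_ : D * (s / D) <= _); last by rewrite mulrCA divff ?mulr1// gt_eqF.
apply: le_trans (cov_tensor_dist_le (r := s / D) _ _ _ _ _ _) _ => //.
- by rewrite [ltLHS]empT ltry.
- by apply: le_lt_trans (probability_le1 _ _) _ => //; rewrite ltry.
- apply: quad_set_rat_dense => //.
  + by rewrite [ltLHS]empT ltry.
  + by apply: le_lt_trans (probability_le1 _ _) _ => //; rewrite ltry.
  move=> q q'; pose k := choice.pickle (q, q').
  have kE : rat_pair k = (q, q') by rewrite /rat_pair choice.pickleK.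
  rewrite empirical_measureE/=.
  apply: le_trans (Fs k.+1).
  have := le_bigmax 0 (fun k : 'I_k.+1 =>
    `|n%:R^-1 * \sum_(i < n) \1_(C k) (y i w) - fine (alpha (C k))|) ord_max.
  by rewrite /= /C kE.
have DE : D - 1 <= D by lra.
apply: le_trans (ler_wpM2r sD0 DE); rewrite le_eqVlt; apply/orP; left.
by apply/eqP; rewrite /D /cov_const addrK !mulrA.
Qed.

(** Monotone convergence in [m] applies since the trace count depends on the [n] points and not on
    the number [m] of sets. *)
Lemma sup_cov_tensor_le (x : R) : 0 < x -> x <= 1 / 2 ->
  (\int[P]_w ereal_sup
     [set (frob_norm (cov_tensor (empirical_measure (y^~ w) n) z sigma
                      - cov_tensor alpha z sigma))%:E
     | z in [set: 'rV[R]_d]] <=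
   (cov_const d sigma * (n%:R^-1 * (2 *
     ((ln (2 * ((n.+1 ^ (d.+1 * d.+1)) ^ 2)%:R) + 1) / x
      + 2 * x * n%:R))))%:E)%E.
Proof.
move=> x0 x1.
apply: (@le_trans _ _ (\int[P]_w limn (G^~ w))%E).
  apply: ge0_le_integralT => w; last exact: cov_le_lim.
  apply: le_trans (ereal_sup_ubound (imageT _ 0)).
  by rewrite lee_fin sqrtr_ge0.
rewrite monotone_convergence//; apply: lime_le.
  apply: ereal_nondecreasing_is_cvgn => m k mk.
  by apply: ge0_le_integral => // w _; exact: G_nd.
apply: nearW => m; rewrite ge0_integralZl//; last 2 first.
- by move=> w _; rewrite lee_fin.
- by rewrite lee_fin ltW.
rewrite EFinM lee_pmul2l ?lte_fin//.
apply: (vc_expectation y_iid (C := fun k : 'I_m => C k)) => //.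
- by move=> k; exact: measurable_quad_set.
- by rewrite expn_gt0 expn_gt0.
- by move=> v; exact: card_quad_set_traces.
Qed.

End sup_deviation.

(** The choice [x = r / 2] balances the two terms because [r^2 n = ln n]: they are at most
    [(4 + 8 k) r n] and [r n], before the factor [2 / n]. *)
Lemma vc_rate_bound (R : realType) (k n : nat) : 1 <= ln n%:R :> R ->
  let r : R := Num.sqrt (ln n%:R / n%:R) in
  0 < r / 2 /\ r / 2 <= 1 / 2 /\
  n%:R^-1 * (2 * ((ln (2 * ((n.+1 ^ k) ^ 2)%:R) + 1) / (r / 2)
                  + 2 * (r / 2) * n%:R)) <= (10 + 16 * k%:R) * r.
Proof.
move=> n1 r; have n0 : 0 < n%:R :> R.
  by rewrite ltNge; apply/negP => /ln0 H; move: n1; rewrite H ler10.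
have L0 : 0 < ln n%:R :> R by exact: lt_le_trans n1.
have r0 : 0 < r by rewrite sqrtr_gt0 divr_gt0.
have r2 : r ^+ 2 * n%:R = ln n%:R.
  by rewrite sqr_sqrtr ?divfK ?gt_eqF// divr_ge0// ltW.
have r1 : r <= 1.
  rewrite -sqrtr1 ler_wsqrtr// ler_pdivrMr// mul1r ltW//.
  exact: ln_sublinear.
split; [lra|split; [lra|]].
have n2 : (2 <= n)%N.
  rewrite ltnNge; apply/negP => n_le1.
  by have := ln_sublinear n0; move: n_le1; rewrite -(ler_nat R); lra.
(* From [n.+1 <= 2 * n <= n ^ 2]. *)
have lnS : ln n.+1%:R <= 2 * ln n%:R :> R.
  rewrite mulr_natl -lnXn// ler_ln ?posrE ?exprn_gt0// -natrX ler_nat.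
  apply: leq_trans (leq_mul n2 (leqnn n)).
  by rewrite mul2n -addnn -addn1 leq_add2l ltnW.
have lnN : ln (2 * ((n.+1 ^ k) ^ 2)%:R) <= 1 + 4 * k%:R * ln n%:R :> R.
  rewrite lnM ?posrE ?ltr0n ?expn_gt0// lerD//.
    by have := @le_ln1Dx R 1; lra.
  rewrite !natrX -exprM lnXn// -[leLHS]mulr_natr natrM.
  have : 0 <= k%:R :> R by [].
  by nra.
have lnN1 : ln (2 * ((n.+1 ^ k) ^ 2)%:R) + 1 <= (2 + 4 * k%:R) * (r ^+ 2 * n%:R).
  rewrite r2; have : 0 <= k%:R :> R by []; nra.
rewrite ler_pdivrMl//.
have : (ln (2 * ((n.+1 ^ k) ^ 2)%:R) + 1) / (r / 2) <=
    (2 + 4 * k%:R) * (r ^+ 2 * n%:R) / (r / 2).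
  by rewrite ler_pM2r// invr_gt0 divr_gt0.
rewrite [X in _ <= X -> _](_ : _ = 2 * (2 + 4 * k%:R) * r * n%:R); last first.
  by field; rewrite gt_eqF.
lra.
Qed.

Theorem corollary4 (R : realType) (d : nat) (sigma : R)
    (Omega : set 'rV[R]_d) (lambda : R) :
  (2 <= d)%N -> 0 < sigma ->
  bounded_set Omega -> connected Omega -> lipschitz_boundary Omega ->
  1 <= lambda ->
  exists (N : nat) (A : R), 0 < A /\
    forall (alpha : probability 'rV[R]_d R) (f : 'rV[R]_d -> R),
      has_density alpha f ->
      (measure_support alpha)° = Omega ->
      (forall z, Omega z -> lambda^-1 <= f z <= lambda) ->
    forall (dT : measure_display) (T : measurableType dT)
        (P : probability T R) (y : nat -> {RV P >-> 'rV[R]_d}),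
      iid_from alpha y ->
    forall n : nat, (N <= n)%N ->
      (\int[P]_w ereal_sup
         [set (frob_norm (cov_tensor (empirical_measure (fun i => y i w) n) x sigma
                          - cov_tensor alpha x sigma))%:E
         | x in [set: 'rV[R]_d]]
       <= (A * rate d n)%:E)%E.
Proof.
move=> d2 s0 _ _ _ _.
pose k := (d.+1 * d.+1)%N.
(* [N] exceeds [expR 1], so [ln n >= 1] from there on; [A] multiplies the tensor constant by that of
   the rate bound, with [k] the exponent in the half-space trace count. *)
exists (Num.trunc (expR 1 : R)).+1, (cov_const d sigma * (10 + 16 * k%:R)).
have k0 : 0 < 10 + 16 * k%:R :> R.
  have : 0 <= k%:R :> R by []; lra.
split; first by rewrite mulr_gt0// cov_const_gt0.
move=> alpha f _ _ _ dT T P y y_iid n Nn.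
have n1 : 1 <= ln n%:R :> R.
  have en : expR 1 <= n%:R :> R.
    by apply: le_trans (_ : (Num.trunc (expR 1 : R)).+1%:R <= _);
      [rewrite ltW// truncnS_gt|rewrite ler_nat].
  rewrite -[X in X <= _]expRK ler_ln ?posrE ?expR_gt0//.
  exact: lt_le_trans en; exact: expR_gt0.
have n0 : (0 < n)%N by exact: leq_trans Nn.
have [r0 [r1 r2]] := vc_rate_bound k n1.
apply: le_trans (sup_cov_tensor_le y_iid s0 n0 r0 r1) _.
rewrite lee_fin -[leRHS]mulrA ler_pM2l ?cov_const_gt0//; apply: le_trans r2 _.
by rewrite ler_pM2l// sqrt_le_rate.
Qed.
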